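(* Let $\Gamma=(X,R)$ be a bipartite distance-regular graph with diameter $D\ge4$ and valency $k\ge3$, fix $x\in X$, let $W$ be a thin irreducible $T(x)$-module with endpoint $2$ and local eigenvalue $\eta$ with $\tilde\theta_1<\eta<\tilde\theta_d$, and let $v$ be a nonzero vector in $E^*_2W$. With respect to the basis $E^*_{i+2}A_iv$ $(0\le i\le D-2)$ of $W$ (in this order), the matrix representing $A$ is the $(D-1)\times(D-1)$ tridiagonal matrix with all diagonal entries $0$, subdiagonal entries $c_1,\dots,c_{D-2}$ and superdiagonal entries $\omega_1,\dots,\omega_{D-2}$, where: (i) if $\eta\ne-1$, then with $\psi=b_2\bigl(1-\frac{b_3}{1+\eta}\bigr)$, $\displaystyle\omega_i=\frac{b_{i+1}c_{i+2}}{c_i}\,\frac{P_{i-1}(\psi)P_{i+2}(\psi)}{P_i(\psi)P_{i+1}(\psi)}$ for $1\le i\le D-2$; (ii) if $\eta=-1$, then $\omega_i=b_{i+1}$ for $1\le i\le D-2$.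
   Context: $\Gamma$ is a finite connected bipartite distance-regular graph with distance $\partial$, intersection numbers $c_i,b_i$ ($c_0=0,b_D=0$). $A_i$ distance matrices, $A=A_1$, eigenvalues $\theta_0>\dots>\theta_D$; $d=\lfloor D/2\rfloor$. $E^*_i$ diagonal with $(y,y)$-entry $1$ if $\partial(x,y)=i$, else $0$; $T(x)$ generated by $A,E^*_0,\dots,E^*_D$; thin: $\dim E^*_iW\le1$ for all $i$; endpoint $\min\{i:E^*_iW\ne0\}$; local eigenvalue of thin irreducible $W$ with endpoint 2: eigenvalue of $E^*_2A_2E^*_2$ on $E^*_2W$. $\tilde\theta_1=-1-b_2b_3(\theta_1^2-b_2)^{-1}$, $\tilde\theta_d=-1-b_2b_3(\theta_d^2-b_2)^{-1}$. Polynomials: $f_0=1,f_{-1}=0$, $\lambda f_i=b_{i-1}f_{i-1}+c_{i+1}f_{i+1}$; $p_i=f_i+f_{i-2}+\cdots$ (ending in $f_0$ or $f_1$ according to parity); $p_i(\lambda)=P_i(\lambda^2)$ for $i$ even, $p_i(\lambda)=\lambda P_i(\lambda^2)$ for $i$ odd. *)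

(* Defs.v *)
From HB Require Import structures.
From mathcomp Require Import all_boot all_order all_algebra.

Set Implicit Arguments.
Unset Strict Implicit.
Unset Printing Implicit Defensive.

Import Order.TTheory GRing.Theory Num.Theory.
Local Open Scope ring_scope.

(* A simple graph is a symmetric irreflexive e : rel X on a finite type X.
   Scalars are taken in an arbitrary numClosedFieldType, of which the field of
   complex numbers is an instance; its order is partial (x <= y means that
   y - x is a nonnegative real), so a < b < c with a real forces b, c real. *)

Definition connected_graph (X : finType) (e : rel X) : Prop :=
  forall y z : X, connect e y z.

Definition bipartite (X : finType) (e : rel X) : Prop :=
  exists col : X -> bool, forall y z : X, e y z -> col y != col z.

Definition walk (X : finType) (e : rel X) (n : nat) (y z : X) : bool :=
  [exists p : n.-tuple X, path e y p && (last y p == z)].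

(* The least length of a walk from y to z.  The search stops at #|X|, which is
   harmless: two vertices of a connected graph are at distance < #|X|. *)
Definition gdist (X : finType) (e : rel X) (y z : X) : nat :=
  find (fun n => walk e n y z) (iota 0 #|X|).

Definition diameter (X : finType) (e : rel X) : nat :=
  (\max_(yz : X * X) gdist e yz.1 yz.2)%N.

Definition valency (X : finType) (e : rel X) (k : nat) : Prop :=
  forall y : X, #|[set z | e y z]| = k.

Definition sphere_meet (X : finType) (e : rel X) (i j : nat) (y z : X) : nat :=
  #|[set w | (gdist e y w == i) && (gdist e w z == j)]|.

Definition distance_regular (X : finType) (e : rel X) : Prop :=
  forall (i j : nat) (y z y' z' : X), gdist e y z = gdist e y' z' ->
    sphere_meet e i j y z = sphere_meet e i j y' z'.

(* p^h_{ij}: the common value of sphere_meet e i j y z over the pairs (y, z) at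
   distance h, read off on one such pair (0 if there is none). *)
Definition pnum (X : finType) (e : rel X) (h i j : nat) : nat :=
  if [pick yz : X * X | gdist e yz.1 yz.2 == h] is Some yz
  then sphere_meet e i j yz.1 yz.2 else 0%N.

(* For i = 0 this is p^0_{10} = 0, which is the convention c_0 = 0. *)
Definition cnum (X : finType) (e : rel X) (i : nat) : nat := pnum e i 1 i.-1.
Definition bnum (X : finType) (e : rel X) (i : nat) : nat := pnum e i 1 i.+1.

(* Matrices and vectors indexed by X, through the enumeration of X. *)

Definition distmx (C : numClosedFieldType) (X : finType) (e : rel X) (i : nat) :
    'M[C]_#|X| :=
  \matrix_(r, s) (gdist e (enum_val r) (enum_val s) == i)%:R.

Definition adjmx (C : numClosedFieldType) (X : finType) (e : rel X) :
    'M[C]_#|X| := distmx C e 1%N.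

(* The dual idempotent E*_i with respect to the vertex x. *)
Definition dualE (C : numClosedFieldType) (X : finType) (e : rel X) (x : X)
    (i : nat) : 'M[C]_#|X| :=
  diag_mx (\row_s (gdist e x (enum_val s) == i)%:R).

Definition ordered_eigenvalues (C : numClosedFieldType) (X : finType)
    (e : rel X) (theta : nat -> C) : Prop :=
  (forall i j : nat, (i < j)%N -> (j <= diameter e)%N -> theta j < theta i) /\
  (forall a : C, eigenvalue (adjmx C e) a <->
     exists2 i : nat, (i <= diameter e)%N & theta i = a).

(* The subalgebra T(x) of the matrix algebra generated by A, E*_0, ..., E*_D. *)
Inductive terwilliger (C : numClosedFieldType) (X : finType) (e : rel X)
    (x : X) : 'M[C]_#|X| -> Prop :=
| Terw_adj : terwilliger e x (adjmx C e)
| Terw_dual i : (i <= diameter e)%N -> terwilliger e x (dualE C e x i)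
| Terw_one : terwilliger e x 1%:M
| Terw_lin a M N : terwilliger e x M -> terwilliger e x N ->
    terwilliger e x (a *: M + N)
| Terw_mul M N : terwilliger e x M -> terwilliger e x N ->
    terwilliger e x (M *m N).

Definition Tmodule (C : numClosedFieldType) (X : finType) (e : rel X) (x : X)
    (W : {vspace 'cV[C]_#|X|}) : Prop :=
  forall (M : 'M[C]_#|X|) (w : 'cV[C]_#|X|),
    terwilliger e x M -> w \in W -> M *m w \in W.

Definition irreducible_Tmodule (C : numClosedFieldType) (X : finType)
    (e : rel X) (x : X) (W : {vspace 'cV[C]_#|X|}) : Prop :=
  [/\ Tmodule e x W, W != 0%VS &
      forall U : {vspace 'cV[C]_#|X|}, Tmodule e x U -> (U <= W)%VS ->
        U = 0%VS \/ U = W].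

(* The subspace E*_i W. *)
Definition Ecomp (C : numClosedFieldType) (X : finType) (e : rel X) (x : X)
    (i : nat) (W : {vspace 'cV[C]_#|X|}) : {vspace 'cV[C]_#|X|} :=
  (linfun (mulmx (dualE C e x i) : 'cV[C]_#|X| -> 'cV[C]_#|X|) @: W)%VS.

Definition thin (C : numClosedFieldType) (X : finType) (e : rel X) (x : X)
    (W : {vspace 'cV[C]_#|X|}) : Prop :=
  forall i : nat, (i <= diameter e)%N -> (\dim (Ecomp e x i W) <= 1)%N.

Definition has_endpoint (C : numClosedFieldType) (X : finType) (e : rel X)
    (x : X) (W : {vspace 'cV[C]_#|X|}) (r : nat) : Prop :=
  Ecomp e x r W != 0%VS /\
  forall i : nat, (i < r)%N -> Ecomp e x i W = 0%VS.

(* eta is an eigenvalue of E*_2 A_2 E*_2 on E*_2 W. *)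
Definition local_eigenvalue (C : numClosedFieldType) (X : finType) (e : rel X)
    (x : X) (W : {vspace 'cV[C]_#|X|}) (eta : C) : Prop :=
  exists w : 'cV[C]_#|X|, [/\ w \in Ecomp e x 2 W, w != 0 &
    dualE C e x 2 *m distmx C e 2 *m dualE C e x 2 *m w = eta *: w].

Definition theta_tilde (C : numClosedFieldType) (X : finType) (e : rel X)
    (t : C) : C :=
  -1 - (bnum e 2)%:R * (bnum e 3)%:R * (t ^+ 2 - (bnum e 2)%:R)^-1.

(* f_{i+1} is solved from 'X f_i = b_{i-1} f_{i-1} + c_{i+1} f_{i+1}, f_{-1} = 0;
   the c_{i+1} are nonzero, hence f_i is the intended polynomial, for i <= D. *)
Fixpoint fpoly (C : numClosedFieldType) (X : finType) (e : rel X) (i : nat) :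
    {poly C} :=
  match i with
  | 0 => 1
  | j.+1 => (cnum e j.+1)%:R^-1 *:
      ('X * fpoly C e j -
       match j with 0 => 0 | l.+1 => (bnum e l)%:R *: fpoly C e l end)
  end.

Definition ppoly (C : numClosedFieldType) (X : finType) (e : rel X) (i : nat) :
    {poly C} :=
  \sum_(j < (i./2).+1) fpoly C e (i - j.*2).

(* even_poly p and odd_poly p are the polynomials with
   p = even_poly p \Po 'X^2 + (odd_poly p \Po 'X^2) * 'X; see PpolyE below. *)
Definition Ppoly (C : numClosedFieldType) (X : finType) (e : rel X) (i : nat) :
    {poly C} :=
  if odd i then odd_poly (ppoly C e i) else even_poly (ppoly C e i).

Lemma fpoly_parity (C : numClosedFieldType) (X : finType) (e : rel X)
    (i j : nat) : odd i != odd j -> (fpoly C e i)`_j = 0.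
Proof.
elim/ltn_ind: i j => -[|i] IH j /= Hij.
  by rewrite coef1; case: j Hij.
rewrite coefZ coefB coefXM.
have -> : (if j == 0%N then 0 else (fpoly C e i)`_j.-1) = 0.
  by case: j Hij => //= j Hij; rewrite IH //; case: (odd i) (odd j) Hij => -[].
case: i IH Hij => [|i] IH Hij; first by rewrite coef0 subr0 mulr0.
rewrite coefZ IH ?mulr0 ?subr0 ?mulr0 //.
by move: Hij; rewrite /= negbK.
Qed.

Lemma ppoly_parity (C : numClosedFieldType) (X : finType) (e : rel X)
    (i j : nat) : odd i != odd j -> (ppoly C e i)`_j = 0.
Proof.
move=> Hij; rewrite coef_sum big1 // => l _; apply: fpoly_parity.
have Hl : (l.*2 <= i)%N.
  rewrite -[leqRHS]odd_double_half; apply: leq_trans (leq_addl _ _).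
  by rewrite leq_double -ltnS.
by rewrite oddB // odd_double addbF.
Qed.

Lemma PpolyE (C : numClosedFieldType) (X : finType) (e : rel X) (i : nat)
    (t : C) :
  (ppoly C e i).[t] = (if odd i then t else 1) * (Ppoly C e i).[t ^+ 2].
Proof.
have H := poly_even_odd (ppoly C e i).
rewrite -{1}H /Ppoly !(hornerE, horner_comp).
case Hi: (odd i).
  have -> : even_poly (ppoly C e i) = 0.
    apply/polyP => j; rewrite coef_even_poly coef0 ppoly_parity //.
    by rewrite Hi odd_double.
  by rewrite horner0 add0r mulrC.
have -> : odd_poly (ppoly C e i) = 0.
  apply/polyP => j; rewrite coef_odd_poly coef0 ppoly_parity //.
  by rewrite Hi /= odd_double.
by rewrite horner0 mul0r addr0 mul1r.
Qed.

Definition psi (C : numClosedFieldType) (X : finType) (e : rel X) (eta : C) :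
    C :=
  (bnum e 2)%:R * (1 - (bnum e 3)%:R / (1 + eta)).

Definition omega (C : numClosedFieldType) (X : finType) (e : rel X) (eta : C)
    (i : nat) : C :=
  if eta == -1 then (bnum e i.+1)%:R
  else
    let P (j : nat) := (Ppoly C e j).[psi e eta] in
    (bnum e i.+1)%:R * (cnum e i.+2)%:R / (cnum e i)%:R *
    (P i.-1 * P i.+2 / (P i * P i.+1)).

(* Zero diagonal, subdiagonal lo 1, ..., lo (n-1), superdiagonal
   up 1, ..., up (n-1): with 0-based indices, lo i is the entry (i, i-1) and
   up i is the entry (i-1, i). *)
Definition tridiag0 (C : numClosedFieldType) (n : nat) (lo up : nat -> C) :
    'M[C]_n :=
  \matrix_(r, s)
    (if r == s.+1 :> nat then lo r
     else if s == r.+1 :> nat then up s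
     else 0).

(* bs is a basis of W and M represents the action of A on W in that basis, with
   the convention A bs_s = sum_r M_{rs} bs_r. *)
Definition represents (C : numClosedFieldType) (m n : nat) (A : 'M[C]_m)
    (W : {vspace 'cV[C]_m}) (bs : n.-tuple 'cV[C]_m) (M : 'M[C]_n) : Prop :=
  basis_of W bs /\
  forall s : 'I_n, A *m tnth bs s = \sum_r M r s *: tnth bs r.

(* Main.v *)
(* Put s_j = p_j(A) v.  Since E*_0 W = E*_1 W = 0, the entries of v sum to 0, and
   s_j has components only in levels j+2 and j: s_j = w_j + beta_j w_{j-2}, where
   w_j = E*_{j+2} A_j v and the second term uses thinness.  Writing
   E*_{i+1} A w_i = om_i w_{i-1} and comparing levels in
   A s_i = c_{i+1} s_{i+1} + b_{i+1} s_{i-1} gives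
     om_i = b_{i+1} + c_{i+1} beta_{i+1} - c_{i-1} beta_i,
     beta_i om_{i-2} = b_{i+1} beta_{i-1},   beta_2 = 1 + eta,
   whose solution is beta_i = - b_i b_{i+1} P_{i-2} / (c_{i-1} c_i P_i) at psi,
   with om_i as claimed; if eta = -1 then all beta_i vanish.

   It remains to see that no w_j (j <= D-2) vanishes.  For 0 < i < D, theta_i is a
   root of p_{D-1}, and p_{D-1}(A) v = 0, so by the Christoffel-Darboux formula
   sum_{j <= D-2} p_j(theta_i) s_j / |p_j|^2 lies in the theta_i-eigenspace of A.
   Its component in level 2 is (1 + (1 + eta)(theta_i^2 - b_2)/(b_2 b_3)) v, which
   is nonzero because of the bounds on eta.  So any A-stable subspace containing v
   has dimension at least D-1. *)

Require Import Defs.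
From HB Require Import structures.
From mathcomp Require Import all_boot all_order all_algebra.
From mathcomp Require Import zify ring.

Set Implicit Arguments.
Unset Strict Implicit.
Unset Printing Implicit Defensive.

Import Order.TTheory GRing.Theory Num.Theory.
Local Open Scope ring_scope.

(** * Graph distance, intersection numbers and counts of neighbours *)

Section Distance.

Variables (X : finType) (e : rel X).
Hypothesis e_sym : symmetric e.
Hypothesis e_conn : connected_graph e.

Lemma walk0 y z : walk e 0 y z = (y == z).
Proof.
apply/existsP/eqP => [[p]|->]; first by rewrite tuple0 /= => /eqP.
by exists [tuple]; rewrite /= eqxx.
Qed.

Lemma walkS n y z : walk e n.+1 y z = [exists w, e y w && walk e n w z].
Proof.
apply/existsP/existsP => [[p]|[w /andP[eyw /existsP[p /andP[pth lst]]]]].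
  case/tupleP: p => w p /= /andP[/andP[eyw pth] lst].
  by exists w; rewrite eyw; apply/existsP; exists p; rewrite pth.
by exists (cons_tuple w p); rewrite /= eyw pth.
Qed.

Lemma walk1 y z : walk e 1 y z = e y z.
Proof.
rewrite walkS; apply/existsP/idP => [[w]|eyz]; last by exists z; rewrite eyz walk0 /=.
by rewrite walk0 => /andP[eyw /eqP <-].
Qed.

Lemma walk_cat m n y w z : walk e m y w -> walk e n w z -> walk e (m + n) y z.
Proof.
elim: m y => [|m IH] y; first by rewrite walk0 => /eqP->.
rewrite addSn !walkS => /existsP[u /andP[eyu wu]] wn.
by apply/existsP; exists u; rewrite eyu IH.
Qed.

Lemma walk_sym n y z : walk e n y z = walk e n z y.
Proof.
wlog suff: y z / walk e n y z -> walk e n z y.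
  by move=> H; apply/idP/idP; apply: H.
elim: n y => [|n IH] y; first by rewrite !walk0 eq_sym.
rewrite walkS => /existsP[u /andP[eyu wu]].
by rewrite -addn1; apply: walk_cat (IH _ wu) _; rewrite walk1 e_sym.
Qed.

Lemma gdist_le n y z : walk e n y z -> (gdist e y z <= n)%N.
Proof.
move=> wn; have [ltn|gen] := ltnP n #|X|; last first.
  by apply: leq_trans gen; rewrite -[leqRHS](size_iota 0); apply: find_size.
rewrite leqNgt; apply/negP => /(before_find 0%N).
by rewrite nth_iota // add0n wn.
Qed.

(** A path without repeated vertices has fewer than [#|X|] edges, so the bounded search in [gdist]
    succeeds. *)
Lemma walk_gdist y z : walk e (gdist e y z) y z.
Proof.
have hasw : has (fun n => walk e n y z) (iota 0 #|X|).
  have /connectP[p pth ->] := e_conn y z.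
  case: (shortenP pth) => q qth quniq _; apply/hasP; exists (size q).
    rewrite mem_iota add0n /= -[(size q).+1]/(size (y :: q)).
    by rewrite -(card_uniqP quniq) max_card.
  by apply/existsP; exists (in_tuple q); rewrite /= qth eqxx.
have := nth_find 0%N hasw; rewrite nth_iota ?add0n //.
by move: hasw; rewrite has_find size_iota.
Qed.

Lemma gdist_sym y z : gdist e y z = gdist e z y.
Proof. by apply/eqP; rewrite eqn_leq !gdist_le // walk_sym walk_gdist. Qed.

Lemma gdist_triangle w y z : (gdist e y z <= gdist e y w + gdist e w z)%N.
Proof. by apply/gdist_le/walk_cat/walk_gdist/walk_gdist. Qed.

Lemma gdist_eq0 y z : (gdist e y z == 0%N) = (y == z).
Proof.
apply/eqP/idP => [d0|]; first by rewrite -walk0 -d0 walk_gdist.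
by rewrite -walk0 => /gdist_le; rewrite leqn0 => /eqP.
Qed.

Lemma gdistxx y : gdist e y y = 0%N.
Proof. by apply/eqP; rewrite gdist_eq0. Qed.

Lemma gdist_step n y z : gdist e y z = n.+1 ->
  exists2 w, e y w & gdist e w z = n.
Proof.
move=> dyz; have := walk_gdist y z; rewrite dyz walkS => /existsP[w /andP[eyw ww]].
exists w => //; apply/eqP; rewrite eqn_leq (gdist_le ww) /= -ltnS -dyz.
by apply: gdist_le; rewrite walkS; apply/existsP; exists w; rewrite eyw walk_gdist.
Qed.

Lemma gdist_diameter y z : (gdist e y z <= diameter e)%N.
Proof. exact: (leq_bigmax (y, z)). Qed.

Lemma exists_gdist (x : X) i : (i <= diameter e)%N ->
  exists yz : X * X, gdist e yz.1 yz.2 = i.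
Proof.
have : exists yz : X * X, gdist e yz.1 yz.2 = diameter e.
  have X2_gt0 : (0 < #|{: X * X}|)%N by apply/card_gt0P; exists (x, x).
  have [yz yzE] := @bigop.eq_bigmax (X * X)%type (fun yz => gdist e yz.1 yz.2) X2_gt0.
  by exists yz; rewrite -yzE.
elim: (diameter e) => [|n IH] ex_n; first by rewrite leqn0 => /eqP->.
rewrite leq_eqVlt ltnS => /orP[/eqP->//|]; apply: IH.
by case: ex_n => -[y z] /gdist_step[w _ wz]; exists (w, z).
Qed.

Hypothesis e_irr : irreflexive e.

Lemma gdist_eq1 y z : (gdist e y z == 1%N) = e y z.
Proof.
apply/eqP/idP => [d1|eyz]; first by rewrite -walk1 -d1 walk_gdist.
apply/eqP; rewrite eqn_leq gdist_le ?walk1 // lt0n gdist_eq0.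
by apply: contraTneq eyz => ->; rewrite e_irr.
Qed.

Hypothesis e_bip : bipartite e.

(** Colours alternate along a walk, so the colours of its ends determine the parity of its
    length. *)
Lemma gdist_parity w y z :
  odd (gdist e y z) = odd (gdist e y w) (+) odd (gdist e w z).
Proof.
have [col colP] := e_bip.
have walkP n a b : walk e n a b -> odd n = col a (+) col b.
  elim: n a => [|n IH] a; first by rewrite walk0 => /eqP->; rewrite addbb.
  rewrite walkS => /existsP[c /andP[/colP eac /IH/= ->]].
  by case: (col a) (col b) (col c) eac => [] [] [].
rewrite !(walkP _ _ _ (walk_gdist _ _)).
by case: (col y) (col z) (col w) => [] [] [].
Qed.

(** The triangle inequality bounds the change by one, and parity excludes no change. *)
Lemma gdist_edge y w z : e y w ->
  (gdist e w z == (gdist e y z).+1) || ((gdist e w z).+1 == gdist e y z).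
Proof.
rewrite -gdist_eq1 => /eqP d1.
have := gdist_parity w y z; have := gdist_triangle w y z.
have := gdist_triangle y w z; rewrite [gdist e w y]gdist_sym d1 /=.
move=> t1 t2 par; have neq : gdist e w z != gdist e y z.
  by apply: contra_eqN par => /eqP->; case: (odd _).
lia.
Qed.

Variable k : nat.
Hypothesis e_val : valency e k.
Hypothesis e_dr : distance_regular e.

Lemma pnumE i j y z : pnum e (gdist e y z) i j = sphere_meet e i j y z.
Proof.
rewrite /pnum; case: pickP => [[a b] /= /eqP dab|/(_ (y, z))]; last by rewrite eqxx.
exact: e_dr.
Qed.

Lemma sphere_meet1 j y z :
  sphere_meet e 1 j y z = #|[set w | e y w && (gdist e w z == j)]|.
Proof. by apply: eq_card => w; rewrite !inE gdist_eq1. Qed.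

Lemma cnumE y z : cnum e (gdist e y z) =
  #|[set w | e y w && ((gdist e w z).+1 == gdist e y z)]|.
Proof.
rewrite /cnum pnumE sphere_meet1; apply: eq_card => w; rewrite !inE.
case: (boolP (e y w)) => //= /(@gdist_edge _ _ z); lia.
Qed.

Lemma bnumE y z : bnum e (gdist e y z) =
  #|[set w | e y w && (gdist e w z == (gdist e y z).+1)]|.
Proof. by rewrite /bnum pnumE sphere_meet1. Qed.

Lemma cnum_add_bnum y z : (cnum e (gdist e y z) + bnum e (gdist e y z))%N = k.
Proof.
rewrite -(e_val y) cnumE bnumE -cardsUI.
rewrite [X in (_ + X)%N]eq_card0 ?addn0 => [|w]; last first.
  by rewrite !inE; case: (e y w) => //=; lia.
apply: eq_card => w; rewrite !inE; case: (boolP (e y w)) => //= /(@gdist_edge _ _ z).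
lia.
Qed.

Lemma cnum1 (x : X) : (0 < diameter e)%N -> cnum e 1 = 1%N.
Proof.
move=> D0; have [[y z] /= d1] := exists_gdist x D0.
rewrite -[in LHS]d1 cnumE -[RHS](cards1 z) d1; apply: eq_card => w; rewrite !inE eqSS gdist_eq0.
by apply: andb_idl => /eqP->; rewrite -gdist_eq1 d1.
Qed.

Lemma cnum_gt0 (x : X) i : (0 < i <= diameter e)%N -> (0 < cnum e i)%N.
Proof.
case: i => // i /= iD; have [[y z] /= dyz] := exists_gdist x iD.
have [w eyw dwz] := gdist_step dyz.
by rewrite -dyz cnumE; apply/card_gt0P; exists w; rewrite inE eyw dwz dyz /=.
Qed.

Lemma bnum_gt0 (x : X) i : (i < diameter e)%N -> (0 < bnum e i)%N.
Proof.
move=> iD; have [[y z] /= dyz] := exists_gdist x iD.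
have [w eyw dwz] := gdist_step dyz.
by rewrite -dwz bnumE; apply/card_gt0P; exists y; rewrite inE e_sym eyw dwz dyz /=.
Qed.

(** Entrywise form of A p_i(A) = c_{i+1} p_{i+1}(A) + b_{i+1} p_{i-1}(A). For distances of the right
    parity: below i all k = c_{i+1} + b_{i+1} neighbours count, at i+1 only the c_{i+1} closer ones,
    farther away none. *)
Lemma card_neighbours_ball i y z : (i.+1 <= diameter e)%N ->
  #|[set w | [&& e y w, (gdist e w z <= i)%N & odd (gdist e w z) == odd i]]| =
  (cnum e i.+1 * ((gdist e y z <= i.+1) && (odd (gdist e y z) != odd i))
   + bnum e i.+1 * ((gdist e y z < i) && (odd (gdist e y z) != odd i)))%N.
Proof.
move=> iD; have [[a b] /= dab] := exists_gdist y iD.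
have par w : e y w -> odd (gdist e w z) = ~~ odd (gdist e y z).
  by move=> eyw; case/orP: (gdist_edge z eyw) => /eqP => [->|<-] //=; rewrite negbK.
case: (boolP (odd (gdist e y z) != odd i)) => [pi|pi]; last first.
  rewrite !andbF !muln0 eq_card0 // => w; rewrite !inE; apply/negbTE/negP => /and3P[eyw _].
  by rewrite par //; move: pi; case: (odd _); case: (odd _).
have pari w : e y w -> (odd (gdist e w z) == odd i).
  by move=> /par->; move: pi; case: (odd _); case: (odd _).
rewrite !andbT; have [lti|gei] := ltnP (gdist e y z) i.
  rewrite (leq_trans (ltnW lti) (leqnSn i)) !muln1 -{1}dab -{1}dab cnum_add_bnum -(e_val y).
  apply: eq_card => w; rewrite !inE; case: (boolP (e y w)) => //= eyw.
  by rewrite pari //; case/orP: (gdist_edge z eyw) => /eqP; lia.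
rewrite muln0 addn0; have [eqi|nei] := eqVneq (gdist e y z) i.+1.
  rewrite -eqi leqnn muln1 cnumE; apply: eq_card => w; rewrite !inE.
  case: (boolP (e y w)) => //= eyw; rewrite pari // andbT.
  by case/orP: (gdist_edge z eyw) => /eqP; lia.
have gti : (i.+1 < gdist e y z)%N.
  move: nei gei pi; case: ltngtP => // lti _ gei; suff -> : gdist e y z = i by rewrite eqxx.
  by apply/eqP; rewrite eqn_leq gei -ltnS lti.
rewrite leqNgt gti muln0 eq_card0 // => w; rewrite !inE; apply/negbTE/negP.
by case/and3P => eyw; case/orP: (gdist_edge z eyw) => /eqP; lia.
Qed.

End Distance.

(** * The matrices p_j(A), the dual idempotents and vectors on level 2 *)

Section Matrices.

Variables (C : numClosedFieldType) (X : finType) (e : rel X).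
Hypothesis e_sym : symmetric e.
Hypothesis e_conn : connected_graph e.
Hypothesis e_irr : irreflexive e.
Hypothesis e_bip : bipartite e.

Local Notation A := (adjmx C e).
Local Notation D := (diameter e).

Lemma sum_enum_val (F : X -> C) : \sum_(r < #|X|) F (enum_val r) = \sum_y F y.
Proof. by rewrite (reindex (@enum_val X X)) //; apply/onW_bij/enum_val_bij. Qed.

Lemma adjmxE r s : A r s = (e (enum_val r) (enum_val s))%:R.
Proof. by rewrite mxE gdist_eq1. Qed.

Lemma adjmx_mulE (w : 'cV[C]_#|X|) r j :
  (A *m w) r j = \sum_(s | e (enum_val r) (enum_val s)) w s j.
Proof.
rewrite mxE [RHS]big_mkcond; apply: eq_bigr => s _.
by rewrite adjmxE; case: (e _ _); rewrite ?mul1r ?mul0r.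
Qed.

(* The matrix A_j + A_{j-2} + ..., i.e. p_j(A) for j <= D. *)
Definition ballmx (j : nat) : 'M[C]_#|X| :=
  \matrix_(r, s) ((gdist e (enum_val r) (enum_val s) <= j)%N &&
                  (odd (gdist e (enum_val r) (enum_val s)) == odd j))%:R.

Lemma ballmx0 : ballmx 0 = 1%:M.
Proof.
apply/matrixP => r s; rewrite !mxE leqn0 gdist_eq0 // (inj_eq enum_val_inj).
by case: eqVneq => [->|//]; rewrite gdistxx.
Qed.

Section DualIdempotents.

Variable x : X.
Local Notation E i := (dualE C e x i).

Lemma dualE_mulE i n (w : 'M[C]_(#|X|, n)) r j :
  (E i *m w) r j = (gdist e x (enum_val r) == i)%:R * w r j.
Proof. by rewrite mul_diag_mx !mxE. Qed.

Lemma dualE_idem i n (w : 'M[C]_(#|X|, n)) : E i *m (E i *m w) = E i *m w.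
Proof. by apply/matrixP => r s; rewrite !dualE_mulE mulrA -natrM mulnb andbb. Qed.

Lemma dualE_gt i n (w : 'M[C]_(#|X|, n)) : (D < i)%N -> E i *m w = 0.
Proof.
move=> Di; apply/matrixP => r s; rewrite dualE_mulE mxE.
by rewrite (ltn_eqF (leq_ltn_trans (gdist_diameter e _ _) Di)) mul0r.
Qed.

Lemma sum_dualE n (w : 'M[C]_(#|X|, n)) : \sum_(i < D.+1) E i *m w = w.
Proof.
apply/matrixP => r s; rewrite summxE.
have ltd : (gdist e x (enum_val r) < D.+1)%N by rewrite ltnS gdist_diameter.
rewrite (bigD1 (Ordinal ltd)) //= dualE_mulE eqxx mul1r big1 ?addr0 // => i.
by rewrite -val_eqE /= dualE_mulE eq_sym => /negPf->; rewrite mul0r.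
Qed.

(** An edge changes the distance to [x] by exactly one, so A sends level i into levels i-1 and
    i+1. *)
Lemma dualE_adj i h (w : 'cV[C]_#|X|) : h != i.+1 -> h.+1 != i ->
  E h *m (A *m (E i *m w)) = 0.
Proof.
move=> hi1 h1i; apply/matrixP => r s; rewrite dualE_mulE adjmx_mulE mxE.
case: eqP => [dr|_]; last by rewrite mul0r.
rewrite mul1r big1 // => t ert; rewrite dualE_mulE.
have := gdist_edge e_sym e_conn e_irr e_bip x ert.
rewrite ![gdist e _ x]gdist_sym // dr.
case: (boolP (gdist e x _ == i)) => [/eqP->|_ _]; last by rewrite mul0r.
by rewrite eq_sym (negPf h1i) eq_sym (negPf hi1).
Qed.

Variable v : 'cV[C]_#|X|.
Hypothesis Ev : E 2 *m v = v.

Lemma level2P r j : gdist e x (enum_val r) != 2 -> v r j = 0.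
Proof. by move=> /negPf d2; rewrite -Ev dualE_mulE d2 mul0r. Qed.

Lemma ballmx_mulE i r j : (ballmx i *m v) r j =
  \sum_(s | (gdist e x (enum_val s) == 2) &&
            ((gdist e (enum_val r) (enum_val s) <= i)%N &&
             (odd (gdist e (enum_val r) (enum_val s)) == odd i))) v s j.
Proof.
rewrite mxE [RHS]big_mkcond; apply: eq_bigr => s _; rewrite mxE.
case: (boolP (_ == 2)) => [_|/level2P->]; last by rewrite mulr0.
by case: (_ && _); rewrite ?mul1r ?mul0r.
Qed.

Lemma dualE_ballmx_far i h : (i.+2 < h)%N -> E h *m (ballmx i *m v) = 0.
Proof.
move=> ih; apply/matrixP => r j; rewrite dualE_mulE ballmx_mulE mxE.
case: eqP => [dr|_]; last by rewrite mul0r.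
rewrite mul1r big_pred0 // => s; apply/negbTE/negP => /and3P[/eqP d2 di _].
have := gdist_triangle e_conn (enum_val s) x (enum_val r).
by rewrite dr d2 [gdist e (enum_val s) _]gdist_sym //; lia.
Qed.

Lemma dualE_ballmx_parity i h : odd i != odd h -> E h *m (ballmx i *m v) = 0.
Proof.
move=> ih; apply/matrixP => r j; rewrite dualE_mulE ballmx_mulE mxE.
case: eqP => [dr|_]; last by rewrite mul0r.
rewrite mul1r big_pred0 // => s; apply/negbTE/negP => /and3P[/eqP d2 _ /eqP par].
have := gdist_parity e_conn e_bip x (enum_val r) (enum_val s).
by rewrite par [gdist e _ x]gdist_sym // dr d2 addbF => /eqP; rewrite (negPf ih).
Qed.

(** A vertex of level i+2 has distance at least i to level 2, so only the term A_i of the ball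
    contributes. *)
Lemma dualE_ballmx_top i : E i.+2 *m (ballmx i *m v) = E i.+2 *m (distmx C e i *m v).
Proof.
apply/matrixP => r j; rewrite !dualE_mulE ballmx_mulE.
case: eqP => [dr|_]; last by rewrite !mul0r.
congr (_ * _); rewrite mxE [LHS]big_mkcond; apply: eq_bigr => s _; rewrite mxE.
case: (boolP (_ == 2)) => [/eqP d2|/level2P->]; last by rewrite mulr0.
have := gdist_triangle e_conn (enum_val s) x (enum_val r).
rewrite dr d2 [gdist e (enum_val s) _]gdist_sym // !ltnS => id.
rewrite eqn_leq id andbT; case: (boolP (_ <= i)%N) => [di|]; last by rewrite mul0r.
have /eqP-> : gdist e (enum_val r) (enum_val s) == i by rewrite eqn_leq di.
by rewrite eqxx mul1r.
Qed.

(** Since p_2(A) = A_2 + I, this is the origin of the 1 in beta_2 = 1 + eta. *)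
Lemma dualE2_ballmx2 : E 2 *m (ballmx 2 *m v) = E 2 *m (distmx C e 2 *m v) + v.
Proof.
have -> : ballmx 2 = distmx C e 2 + 1%:M.
  rewrite -ballmx0; apply/matrixP => r s; rewrite !mxE -natrD; congr _%:R.
  by case: (gdist e _ _) => [|[|[|n]]].
by rewrite mulmxDl mul1mx mulmxDr Ev.
Qed.

Hypothesis sum_v : \sum_r v r 0 = 0.

(** With the wrong parity the sum over level 2 is empty; with the right one the ball contains all of
    level 2, and the sum is the total of the entries of v. *)
Lemma ballmx_mul_eq0 i (r : 'I_#|X|) :
  (forall s : 'I_#|X|, gdist e x (enum_val s) = 2 ->
     odd (gdist e (enum_val r) (enum_val s)) == odd i ->
     (gdist e (enum_val r) (enum_val s) <= i)%N) -> (ballmx i *m v) r 0 = 0.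
Proof.
have parE (s : 'I_#|X|) : gdist e x (enum_val s) = 2 ->
    odd (gdist e (enum_val r) (enum_val s)) = odd (gdist e x (enum_val r)).
  by move=> d2; rewrite (gdist_parity e_conn e_bip x) d2 addbF gdist_sym.
move=> near; rewrite ballmx_mulE.
case: (boolP (odd (gdist e x (enum_val r)) == odd i)) => par.
  rewrite -[RHS]sum_v [LHS]big_mkcond; apply: eq_bigr => s _.
  case: (boolP (_ == 2)) => [/eqP d2|/level2P->//].
  by rewrite near ?parE // par.
rewrite big_pred0 // => s; apply/negbTE; rewrite !negb_and.
by case: (boolP (_ == 2)) => //= /eqP d2; rewrite parE // par orbT.
Qed.

Lemma dualE_ballmx_near i h : (h.+2 <= i)%N -> E h *m (ballmx i *m v) = 0.
Proof.
move=> hi; apply/colP => r; rewrite dualE_mulE [RHS]mxE.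
case: eqP => [dr|_]; last by rewrite mul0r.
rewrite ballmx_mul_eq0 ?mulr0 // => s d2 _; apply: leq_trans hi.
apply: leq_trans (gdist_triangle e_conn x _ _) _.
by rewrite d2 gdist_sym // dr addn2.
Qed.

(** Only the distance D exceeds D-1, and it has the other parity, so the ball imposes nothing beyond
    parity. *)
Lemma ballmx_diameter_pred : (0 < D)%N -> ballmx D.-1 *m v = 0.
Proof.
move=> D0; apply/colP => r; rewrite [RHS]mxE ballmx_mul_eq0 // => s _ par.
have := gdist_diameter e (enum_val r) (enum_val s).
case: ltngtP par => // [lt _ _|-> ]; first by rewrite -ltnS prednK.
by case: (diameter e) D0 => //= n _; case: (odd n).
Qed.

End DualIdempotents.

Section Regular.

Variable k : nat.
Hypothesis e_val : valency e k.
Hypothesis e_dr : distance_regular e.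

Lemma adj_ballmx i : (i < D)%N -> A *m ballmx i =
  (cnum e i.+1)%:R *: ballmx i.+1 +
  (bnum e i.+1)%:R *: (if i is i'.+1 then ballmx i' else 0).
Proof.
move=> iD; apply/matrixP => r s; rewrite [LHS]mxE.
pose F w := ([&& e (enum_val r) w, (gdist e w (enum_val s) <= i)%N &
  odd (gdist e w (enum_val s)) == odd i])%:R : C.
rewrite (eq_bigr (fun t => F (enum_val t))) => [|t _]; last first.
  by rewrite adjmxE mxE -natrM mulnb.
rewrite sum_enum_val -natr_sum.
have -> : (\sum_y [&& e (enum_val r) y, (gdist e y (enum_val s) <= i)%N &
    odd (gdist e y (enum_val s)) == odd i] = #|[set y | [&& e (enum_val r) y,
    (gdist e y (enum_val s) <= i)%N & odd (gdist e y (enum_val s)) == odd i]]|)%N.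
  by rewrite -sum1dep_card [RHS]big_mkcond; apply: eq_bigr => y _; case: (_ && _).
rewrite (card_neighbours_ball e_sym e_conn e_irr e_bip e_val) //.
rewrite natrD !natrM !mxE; congr (_ * _%:R + _ * _).
  by congr (_ && _); rewrite /=; case: (odd _) (odd i) => [] [].
by case: i {F iD} => [|i]; rewrite mxE //=; congr (_ && _)%:R; case: (odd _) (odd i) => [] [].
Qed.

End Regular.

End Matrices.

(** * Recurrences for the polynomials f_i, p_i and P_i *)

Section Polynomials.

Variables (C : numClosedFieldType) (X : finType) (e : rel X).
Hypothesis e_sym : symmetric e.
Hypothesis e_conn : connected_graph e.
Hypothesis e_irr : irreflexive e.
Hypothesis e_bip : bipartite e.
Variable k : nat.
Hypothesis e_val : valency e k.
Hypothesis e_dr : distance_regular e.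
Variable x : X.

Local Notation D := (diameter e).
Local Notation c i := ((cnum e i)%:R : C).
Local Notation b i := ((bnum e i)%:R : C).

Lemma cnum_neq0 i : (0 < i <= D)%N -> c i != 0.
Proof. by move=> iD; rewrite pnatr_eq0 -lt0n (cnum_gt0 e_sym e_conn e_irr e_bip e_dr x). Qed.

Lemma bnum_neq0 i : (i < D)%N -> b i != 0.
Proof. by move=> iD; rewrite pnatr_eq0 -lt0n (bnum_gt0 e_sym e_conn e_irr e_dr x). Qed.

Lemma cnum_bnum i : (i <= D)%N -> c i + b i = k%:R.
Proof.
move=> iD; have [[y z] /= <-] := exists_gdist e_conn x iD.
by rewrite -natrD (cnum_add_bnum e_sym e_conn e_irr e_bip e_val).
Qed.

Lemma bnum0 : b 0 = k%:R.
Proof.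
rewrite -(e_val x) -{1}(gdistxx e_conn x) bnumE // gdistxx //; congr (_%:R).
by apply: eq_card => w; rewrite !inE gdist_sym // gdist_eq1 // andbb.
Qed.

Lemma fpoly_rec i : (i < D)%N -> 'X * fpoly C e i =
  c i.+1 *: fpoly C e i.+1 + (if i is j.+1 then b j *: fpoly C e j else 0).
Proof.
move=> iD; rewrite /= scalerA mulfV ?cnum_neq0 // scale1r.
by case: i {iD} => [|i]; rewrite ?subr0 ?addr0 ?subrK.
Qed.

Lemma ppolySS i : ppoly C e i.+2 = fpoly C e i.+2 + ppoly C e i.
Proof.
rewrite /ppoly big_ord_recl; congr (_ + _); exact: eq_bigr.
Qed.

Lemma ppoly0 : ppoly C e 0 = 1.
Proof. by rewrite /ppoly big_ord_recl big_ord0 addr0. Qed.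

Lemma ppoly1 : ppoly C e 1 = fpoly C e 1.
Proof. by rewrite /ppoly big_ord_recl big_ord0 addr0. Qed.

(** Writing p_i = f_i + p_{i-2}, the two recurrences together give p_{i-1} the coefficient b_{i-1} +
    c_{i-1} = k; splitting k as c_{i+1} + b_{i+1} completes c_{i+1} f_{i+1} to c_{i+1} p_{i+1}. *)
Lemma ppoly_rec i : (i < D)%N -> 'X * ppoly C e i =
  c i.+1 *: ppoly C e i.+1 + b i.+1 *: (if i is j.+1 then ppoly C e j else 0).
Proof.
elim/ltn_ind: i => -[|[|i]] IH iD.
- by rewrite ppoly0 ppoly1 -[1]/(fpoly C e 0) fpoly_rec // scaler0.
- rewrite ppolySS ppoly0 ppoly1 fpoly_rec // scalerDr -addrA -scalerDl cnum_bnum //.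
  by rewrite -bnum0.
- rewrite ppolySS mulrDr fpoly_rec // IH //; last by lia.
  rewrite ppolySS scalerDr -!addrA; congr (_ + _).
  rewrite -scalerDl cnum_bnum // -(cnum_bnum (i := i.+1)) 1?ltnW // 1?ltnW //.
  rewrite scalerDl addrCA; congr (_ + _); case: i {IH iD} => [|i].
    by rewrite scaler0 addr0 ppoly1.
  by rewrite -scalerDr -ppolySS.
Qed.

Lemma ppoly_horner_rec i t : (i < D)%N -> t * (ppoly C e i).[t] =
  c i.+1 * (ppoly C e i.+1).[t] +
  b i.+1 * (if i is j.+1 then (ppoly C e j).[t] else 0).
Proof.
move=> iD; have := congr1 (fun p => p.[t]) (ppoly_rec iD).
by rewrite /= !hornerE => ->; case: i {iD} => [|i]; rewrite ?hornerE.
Qed.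

(** The odd or even part of the recurrence for p_{i+1}, with t in place of the squared variable. The
    factor ['X] turns an odd p_{i+1} into t P_{i+1}(t), but is absorbed by the odd part when p_{i+1}
    is even. *)
Lemma Ppoly_rec i t : (i.+1 < D)%N ->
  (if odd i then 1 else t) * (Ppoly C e i.+1).[t] =
  c i.+2 * (Ppoly C e i.+2).[t] + b i.+2 * (Ppoly C e i).[t].
Proof.
move=> iD; have := ppoly_rec iD; rewrite mulrC /Ppoly /= negbK.
case: (odd i) => /= [/(congr1 (@odd_poly C))|/(congr1 (@even_poly C))].
  by rewrite odd_polyMX odd_polyD !odd_polyZ => ->; rewrite !hornerE.
rewrite even_polyMX even_polyD !even_polyZ => /(congr1 (fun p => p.[t])).
by rewrite /= !hornerE mulrC.
Qed.

Lemma Ppoly0 : Ppoly C e 0 = 1.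
Proof.
rewrite /Ppoly /= ppoly0; apply/polyP => i.
by rewrite coef_even_poly !coef1 double_eq0.
Qed.

Lemma Ppoly1 : (0 < D)%N -> Ppoly C e 1 = 1.
Proof.
move=> D0; rewrite /Ppoly /= ppoly1 /= subr0 mulr1.
rewrite (cnum1 e_sym e_conn e_irr e_bip e_dr x) // invr1 scale1r.
by apply/polyP => -[|i]; rewrite coef_odd_poly coefX coef1.
Qed.

Local Notation A := (adjmx C e).

(** [ballmx] and [ppoly] have the same recurrence and the same start, and each c_{i+1} can be
    cancelled. *)
Lemma ballmx_eigenvector i n t (u : 'M[C]_(#|X|, n)) : (i <= D)%N ->
  A *m u = t *: u -> ballmx C e i *m u = (ppoly C e i).[t] *: u.
Proof.
move=> iD Au; suff: (forall j, (j <= i)%N -> ballmx C e j *m u = (ppoly C e j).[t] *: u).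
  exact.
elim: i iD => [|i IH] iD j; first by
  rewrite leqn0 => /eqP->; rewrite ballmx0 // ppoly0 hornerC scale1r mul1mx.
rewrite leq_eqVlt => /orP[/eqP->|]; last by apply: IH; apply: ltnW.
have IHi := IH (ltnW iD); have c0 : c i.+1 != 0 by rewrite cnum_neq0.
have := congr1 (fun M => M *m u)
  (adj_ballmx C e_sym e_conn e_irr e_bip e_val e_dr iD).
rewrite /= -mulmxA IHi // -scalemxAr Au scalerA mulrC.
rewrite ppoly_horner_rec // mulmxDl -!scalemxAl scalerDl => eq1.
apply: (scalerI c0); rewrite scalerA; apply: (addIr ((b i.+1 *
  (if i is j.+1 then (ppoly C e j).[t] else 0)) *: u)).
rewrite eq1; congr (_ + _); case: i {IH iD c0 eq1} IHi => [|i] IHi.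
  by rewrite mulr0 scale0r mul0mx scaler0.
by rewrite IHi // scalerA.
Qed.

End Polynomials.

(** * Uniqueness of strictly decreasing enumerations *)

Section DecreasingEnumerations.

Variables (d : Order.disp_t) (T : porderType d).

Lemma decreasing_enum_unique (f g : nat -> T) n :
  (forall i j, (i < j)%N -> (j <= n)%N -> (f j < f i)%O) ->
  (forall i j, (i < j)%N -> (j <= n)%N -> (g j < g i)%O) ->
  (forall a, (exists2 i, (i <= n)%N & f i = a) <->
             (exists2 i, (i <= n)%N & g i = a)) ->
  forall i, (i <= n)%N -> f i = g i.
Proof.
move=> fdec gdec fg i le_in.
have sortd (h : nat -> T) : (forall i j, (i < j)%N -> (j <= n)%N -> (h j < h i)%O) ->
    sorted >%O [seq h i | i <- iota 0 n.+1].
  move=> hdec; apply/(sortedP (h 0)) => j; rewrite size_map size_iota => lt_j.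
  by rewrite !(nth_map 0%N) ?size_iota ?nth_iota ?(ltnW lt_j) // !add0n; apply: hdec.
have memE (h : nat -> T) a :
    a \in [seq h i | i <- iota 0 n.+1] <-> exists2 i, (i <= n)%N & h i = a.
  split=> [/mapP[j]|[j jn <-]]; last by rewrite map_f // mem_iota.
  by rewrite mem_iota /= add0n ltnS => jn ->; exists j.
have eq_map : [seq f i | i <- iota 0 n.+1] = [seq g i | i <- iota 0 n.+1].
  have gt_tr : transitive (>%O : rel T) by move=> y x z /= yx zy; apply: lt_trans zy yx.
  have gt_irr : irreflexive (>%O : rel T) by move=> y; apply: ltxx.
  apply: (irr_sorted_eq gt_tr gt_irr (sortd _ fdec) (sortd _ gdec)) => a.
  by apply/idP/idP => /memE/fg/memE.
have /(congr1 (fun s => nth (f 0) s i)) := eq_map.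
by rewrite !(nth_map 0%N) ?size_iota // nth_iota // add0n.
Qed.

End DecreasingEnumerations.

(** * The spectrum of A: extreme eigenvalues, symmetry, and roots of p_{D-1} *)

Section Spectrum.

Variables (C : numClosedFieldType) (X : finType) (e : rel X).
Hypothesis e_sym : symmetric e.
Hypothesis e_conn : connected_graph e.
Hypothesis e_irr : irreflexive e.
Hypothesis e_bip : bipartite e.
Variable k : nat.
Hypothesis e_val : valency e k.
Variable x : X.

Local Notation A := (adjmx C e).
Local Notation D := (diameter e).

Lemma adjmx_sym : A^T = A.
Proof. by apply/matrixP => r s; rewrite !mxE gdist_sym. Qed.

(** [eigenvalue] speaks of row vectors; the symmetry of A turns them into columns. *)
Lemma adjmx_eigenP t :
  reflect (exists2 u : 'cV[C]_#|X|, A *m u = t *: u & u != 0) (eigenvalue A t).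
Proof.
apply: (iffP eigenvalueP) => -[u uA u0]; exists u^T; rewrite ?trmx_eq0 //.
  by rewrite -[A in LHS]adjmx_sym -trmx_mul uA linearZ.
by rewrite -[A in LHS]adjmx_sym -trmx_mul uA linearZ.
Qed.

Lemma sum_neighbours (a : C) (r : 'I_#|X|) :
  \sum_(s < #|X| | e (enum_val r) (enum_val s)) a = k%:R * a.
Proof.
rewrite big_mkcond (sum_enum_val (fun y => if e (enum_val r) y then a else 0)).
by rewrite -big_mkcond sumr_const mulr_natl -(e_val (enum_val r)) cardsE.
Qed.

Lemma valency_eigenvalue : eigenvalue A k%:R.
Proof.
apply/adjmx_eigenP; exists (const_mx 1).
  apply/colP => r; rewrite adjmx_mulE // !mxE -(sum_neighbours _ r).
  by apply: eq_bigr => s _; rewrite mxE.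
by apply/eqP => /colP/(_ (enum_rank x)); rewrite !mxE => /eqP; rewrite oner_eq0.
Qed.

(** Every edge joins the two colour classes, so changing the sign of an eigenvector on one class
    negates the eigenvalue. *)
Lemma opp_eigenvalue t : eigenvalue A t -> eigenvalue A (- t).
Proof.
have [side sideP] := e_bip; move=> /adjmx_eigenP[u Au u0]; apply/adjmx_eigenP.
exists (\col_r ((-1) ^+ side (enum_val r) * u r 0)).
  apply/colP => r; rewrite adjmx_mulE // !mxE mulrCA mulNr -[t * _]/(t * u r 0).
  have := congr1 (fun w : 'cV_#|X| => w r 0) Au; rewrite adjmx_mulE // mxE => <-.
  rewrite mulrN mulr_sumr -sumrN; apply: eq_bigr => s ers; rewrite mxE -mulNr.
  by congr (_ * _); have := sideP _ _ ers; case: (side _) (side _) => [] [] //; rewrite opprK.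
apply: contra_neq u0 => /colP u0; apply/colP => r; have := u0 r; rewrite !mxE => /eqP.
by rewrite mulf_eq0 signr_eq0 => /eqP.
Qed.

(* Compare the 1-norms of the two sides of A u = t u. *)
Lemma eigenvalue_norm_le t : eigenvalue A t -> `|t| <= k%:R.
Proof.
move=> /adjmx_eigenP[u Au u0].
have S0 : 0 < \sum_r `|u r 0|.
  rewrite lt_neqAle sumr_ge0 // andbT eq_sym; apply: contra_neq u0 => /eqP.
  rewrite psumr_eq0 // => /allP u0; apply/colP => r; rewrite mxE; apply/eqP.
  by rewrite -normr_eq0; apply: (u0 r); rewrite mem_index_enum.
rewrite -(ler_pM2r S0) !mulr_sumr.
have -> : \sum_r k%:R * `|u r 0| =
    \sum_(r < #|X|) \sum_(s < #|X| | e (enum_val r) (enum_val s)) `|u s 0|.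
  rewrite (exchange_big_dep predT) //=; apply: eq_bigr => s _.
  by rewrite -(sum_neighbours _ s); apply: eq_bigl => r; rewrite e_sym.
apply: ler_sum => r _; rewrite -normrM.
have -> : t * u r 0 = (A *m u) r 0 by rewrite Au mxE.
by rewrite adjmx_mulE // ler_norm_sum.
Qed.

(** The sum of all A_i with i of parity [p]. *)
Definition parity_mx (p : bool) : 'M[C]_#|X| :=
  \matrix_(r, s) (odd (gdist e (enum_val r) (enum_val s)) == p)%:R.

Lemma adj_parity_mx p : A *m parity_mx p = k%:R *: parity_mx (~~ p).
Proof.
apply/matrixP => r s; rewrite [LHS]mxE [RHS]mxE -(sum_neighbours _ r) [RHS]big_mkcond.
apply: eq_bigr => t _; rewrite adjmxE // !mxE.
case: (boolP (e _ _)) => ert; rewrite ?mul0r // mul1r.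
congr _%:R; rewrite (gdist_parity e_conn e_bip (enum_val t) (enum_val r)).
by move: ert; rewrite -gdist_eq1 // => /eqP->; case: (odd _) p => [] [].
Qed.

Lemma ballmx_diameterE : (0 < D)%N -> ballmx C e D.-1 = parity_mx (odd D.-1).
Proof.
move=> D0; apply/matrixP => r s; rewrite !mxE; congr (nat_of_bool _)%:R; apply: andb_idl => par.
have := gdist_diameter e (enum_val r) (enum_val s).
case: ltngtP par => // [lt _ _|-> ]; first by rewrite -ltnS prednK.
by case: (diameter e) D0 => //= n _; case: (odd n).
Qed.

Hypothesis e_dr : distance_regular e.

(* p_{D-1}(A) is a parity matrix, so A^2 multiplies it by k^2. *)
Lemma ppoly_diameter_root t : (0 < D)%N -> eigenvalue A t -> t != k%:R -> t != - k%:R ->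
  (ppoly C e D.-1).[t] = 0.
Proof.
move=> D0 /adjmx_eigenP[u Au u0] tk tNk.
have Pu := ballmx_eigenvector e_sym e_conn e_irr e_bip e_val e_dr x (leq_pred D) Au.
have Pcomm : A *m (A *m (ballmx C e D.-1 *m u)) = k%:R ^+ 2 *: (ballmx C e D.-1 *m u).
  by rewrite ballmx_diameterE // !mulmxA -[A *m A *m _]mulmxA adj_parity_mx
    -scalemxAr adj_parity_mx negbK scalerA -expr2 scalemxAl.
move: Pcomm; rewrite Pu -!scalemxAr Au -scalemxAr Au !scalerA => /eqP.
rewrite -subr_eq0 -scalerBl scaler_eq0 (negPf u0) orbF.
rewrite -mulrA -expr2 [X in X - _]mulrC -mulrBl mulf_eq0 subr_sqr mulf_eq0 subr_eq0 addr_eq0.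
by rewrite (negPf tk) (negPf tNk) => /eqP.
Qed.

Variable theta : nat -> C.
Hypothesis htheta : ordered_eigenvalues e theta.

Lemma theta_eigenvalue i : (i <= D)%N -> eigenvalue A (theta i).
Proof. by move=> iD; have [_ ev] := htheta; apply/ev; exists i. Qed.

Lemma theta_le i j : (i <= j)%N -> (j <= D)%N -> theta j <= theta i.
Proof.
have [dec _] := htheta; rewrite leq_eqVlt => /orP[/eqP->//|lij] jD.
exact/ltW/dec.
Qed.

Lemma theta0 : theta 0 = k%:R.
Proof.
have [i iD ki] : exists2 i, (i <= D)%N & theta i = k%:R.
  by have [_ ev] := htheta; apply/ev; apply: valency_eigenvalue.
have lek : k%:R <= theta 0 by rewrite -ki theta_le.
apply: le_anti; rewrite lek andbT; have := eigenvalue_norm_le (theta_eigenvalue (leq0n D)).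
by rewrite ger0_norm //; apply: le_trans lek; rewrite ler0n.
Qed.

(** In the partial order of C, being comparable with the real number theta_0 = k forces theta_i to
    be real. *)
Lemma theta_real i : (i <= D)%N -> theta i \is Num.real.
Proof.
by move=> iD; rewrite (ler_real (theta_le (leq0n i) iD)) theta0 realn.
Qed.

(** The spectrum is closed under negation, so the numbers -theta_{D-i} form another decreasing
    enumeration of it. *)
Lemma theta_opp i : (i <= D)%N -> theta (D - i) = - theta i.
Proof.
have [dec ev] := htheta; move=> iD; apply/eqP; rewrite -eqr_oppLR; apply/eqP.
apply/esym; move: i iD; apply: decreasing_enum_unique => [//|i j lij jD|a].
  by rewrite ltrN2 dec //; lia.
split=> [[i iD tia]|[i iD tia]].
  have /opp_eigenvalue/ev[j jD tj] := theta_eigenvalue iD.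
  by exists (D - j)%N; rewrite ?leq_subr // subKn // tj opprK.
have := opp_eigenvalue (theta_eigenvalue (leq_subr i D)).
by rewrite tia => /ev[j jD tj]; exists j.
Qed.

Lemma ppoly_theta i : (0 < i < D)%N -> (ppoly C e D.-1).[theta i] = 0.
Proof.
have [dec ev] := htheta; case/andP => i0 iD; have D0 := ltn_trans i0 iD.
apply: ppoly_diameter_root => //; first exact/theta_eigenvalue/ltnW.
  by rewrite -theta0 lt_eqF // dec // ltnW.
by rewrite -theta0 -theta_opp // subn0 gt_eqF // dec.
Qed.

Lemma theta_sqr_bounds i : (0 < i < D)%N ->
  theta D./2 ^+ 2 <= theta i ^+ 2 <= theta 1 ^+ 2.
Proof.
case/andP => i0 iD.
have d_le : (D./2 <= D - D./2)%N by rewrite -{2}(odd_double_half D) -addnn; lia.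
have dD : (D./2 <= D)%N by lia.
(* Sums of eigenvalues become differences, so both factors of a difference of squares get their
   signs from monotonicity. *)
have addE j h : (h <= D)%N -> theta j + theta h = theta j - theta (D - h).
  by move=> hD; rewrite theta_opp // opprK.
rewrite -![_ <= _ ^+ 2]subr_ge0 !subr_sqr; apply/andP; split; last first.
  rewrite [X in _ * X]addrC addE 1?(leq_trans i0 (ltnW iD)) //.
  by apply: mulr_ge0; rewrite subr_ge0 theta_le //; lia.
rewrite addE //; have [id|di] := leqP i D./2.
  by apply: mulr_ge0; rewrite subr_ge0 theta_le //; lia.
(* For i > d, D <= 2d + 1 gives i >= D - d, and both factors are nonpositive. *)
by apply: mulr_le0; rewrite subr_le0 theta_le //; lia.
Qed.

(* The quantity vanishes exactly when eta = -1 - b_2 b_3 / (theta_i^2 - b_2),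
   i.e. when psi = theta_i^2, whereas the bounds on eta put psi outside
   [theta_d^2, theta_1^2]. *)
Lemma theta_tilde_gap eta i : (0 < i < D)%N ->
  theta_tilde e (theta 1) < eta -> eta < theta_tilde e (theta D./2) ->
  0 < ((bnum e 2)%:R * (bnum e 3)%:R : C) ->
  1 + (1 + eta) * ((theta i ^+ 2 - (bnum e 2)%:R) / ((bnum e 2)%:R * (bnum e 3)%:R)) != 0.
Proof.
rewrite /theta_tilde; set B := (bnum e 2)%:R * (bnum e 3)%:R : C => iD eta1 etad B0.
have sreal j : (j <= D)%N -> theta j ^+ 2 - (bnum e 2)%:R \is Num.real.
  by move=> jD; rewrite rpredB ?rpredX ?theta_real ?realn.
have /andP[] := theta_sqr_bounds iD; case/andP: iD => i0 iD ledi lei1.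
have {}ledi : theta D./2 ^+ 2 - (bnum e 2)%:R <= theta i ^+ 2 - (bnum e 2)%:R by rewrite lerD2r.
have {}lei1 : theta i ^+ 2 - (bnum e 2)%:R <= theta 1 ^+ 2 - (bnum e 2)%:R by rewrite lerD2r.
have ri := sreal i (ltnW iD); move: ledi lei1 eta1 etad ri.
set s1 := theta 1 ^+ 2 - _; set si := theta i ^+ 2 - _; set sd := theta D./2 ^+ 2 - _.
move=> ledi lei1 eta1 etad ri; apply/eqP => eq0.
have si0 : si != 0.
  by apply/eqP => s0; move/eqP: eq0; rewrite s0 mul0r mulr0 addr0 oner_eq0.
have etaE : eta = -1 - B * si^-1.
  apply: (mulIf si0); have B0' : B != 0 by rewrite gt_eqF.
  move: eq0 => /(congr1 (fun z => B * z)); rewrite mulr0 => eq0.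
  by apply/eqP; rewrite -subr_eq0 -eq0; apply/eqP; field; rewrite si0 B0'.
move: eta1 etad; rewrite etaE !ltrD2l !ltrN2 !(ltr_pM2l B0) => lt1 ltd.
(* Inversion reverses the order among numbers of one sign: a negative [si] is compared with [sd],
   then negative too, and a positive one with [s1]. *)
have [si_lt|si_gt|si_eq] := real_ltgtP ri (real0 _); last by rewrite si_eq eqxx in si0.
  have sd_lt := le_lt_trans ledi si_lt.
  by have := lt_geF ltd; rewrite lef_nV2 ?ledi // ?posrE ?negrE.
have s1_gt := lt_le_trans si_gt lei1.
by have := lt_geF lt1; rewrite lef_pV2 ?lei1 // posrE.
Qed.

End Spectrum.

(** * Solving the scalar recursion for beta_i and omega_i *)

Section ScalarRecursion.

Variables (F : fieldType) (D : nat) (c b P beta om : nat -> F) (t : F).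
Hypothesis c_neq0 : forall i, (0 < i <= D)%N -> c i != 0.
Hypothesis b_neq0 : forall i, (i < D)%N -> b i != 0.
Hypothesis om_neq0 : forall j, (j.+2 < D)%N -> om j.+1 != 0.
Hypothesis om1 : om 1 = c 2 * beta 2 + b 2.
Hypothesis omSS : forall j, (j.+3 < D)%N ->
  om j.+2 + beta j.+2 * c j.+1 = c j.+3 * beta j.+3 + b j.+3.
Hypothesis beta_rec : forall j, (j.+3 < D)%N ->
  beta j.+3 * om j.+1 = b j.+4 * beta j.+2.

(** As om never vanishes, [beta_rec] propagates beta_2 = 0 to all later beta. *)
Lemma om_of_beta2_eq0 : beta 2 = 0 -> forall j, (j.+2 < D)%N -> om j.+1 = b j.+2.
Proof.
move=> beta2.
have beta0 j : (j.+2 < D)%N -> beta j.+2 = 0.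
  elim: j => [//|j IH] jD; apply: (mulIf (om_neq0 (ltnW jD))).
  by rewrite mul0r beta_rec // IH ?mulr0 // ltnW.
case=> [|j] jD; first by rewrite om1 beta2 mulr0 add0r.
by have := omSS jD; rewrite !beta0 ?mul0r ?mulr0 ?addr0 ?add0r // ltnW.
Qed.

Hypothesis c1 : c 1 = 1.
Hypothesis P0 : P 0 = 1.
Hypothesis P1 : P 1 = 1.
Hypothesis P_rec : forall i, (i.+1 < D)%N ->
  (if odd i then 1 else t) * P i.+1 = c i.+2 * P i.+2 + b i.+2 * P i.
Hypothesis beta2_neq0 : beta 2 != 0.
Hypothesis beta2E : beta 2 * (t - b 2) = - b 2 * b 3.

(** Denominators are cleared, and the nonvanishing of P_{j+2} travels along in the induction so that
    cancelling is allowed. *)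
Let beta_formula j := P j.+2 != 0 /\
  beta j.+2 * (c j.+1 * c j.+2 * P j.+2) = - b j.+2 * b j.+3 * P j.

Let om_formula j := om j.+1 * (c j.+1 * P j.+1 * P j.+2) =
  b j.+2 * c j.+3 * P j * P j.+3.

Lemma om_formula0 : (2 < D)%N -> beta_formula 0 -> om_formula 0.
Proof.
rewrite /om_formula /beta_formula om1 c1 P0 P1 => D2 [_ betaE].
have := P_rec (i := 1) D2; rewrite /= P1 => P2.
have -> : (c 2 * beta 2 + b 2) * (1 * 1 * P 2) = beta 2 * (1 * c 2 * P 2) + b 2 * P 2 by ring.
by rewrite betaE -[P 2]mul1r P2; ring.
Qed.

Lemma om_formulaS j : (j.+3 < D)%N -> beta_formula j -> beta_formula j.+1 ->
  om_formula j.+1.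
Proof.
move=> jD [_ betaE] [_ betaSE]; rewrite /om_formula.
have omE : om j.+2 = c j.+3 * beta j.+3 + b j.+3 - beta j.+2 * c j.+1.
  by rewrite -omSS // addrK.
(* The indices j and j+2 have the same parity, so [lo] and [hi] carry the same factor 1 or t, which
   is moved below from P_{j+3} to P_{j+1}. *)
have lo := P_rec (ltn_trans (ltnW (ltnSn j.+2)) jD).
have hi := P_rec jD; rewrite /= negbK in hi.
have -> : om j.+2 * (c j.+2 * P j.+2 * P j.+3) =
    beta j.+3 * (c j.+2 * c j.+3 * P j.+3) * P j.+2 + b j.+3 * c j.+2 * P j.+2 * P j.+3
    - beta j.+2 * (c j.+1 * c j.+2 * P j.+2) * P j.+3 by rewrite omE; ring.
have cP : c j.+4 * P j.+4 = (if odd j then 1 else t) * P j.+3 - b j.+4 * P j.+2.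
  by rewrite hi addrK.
have -> : b j.+3 * c j.+4 * P j.+1 * P j.+4 = b j.+3 * P j.+1 * (c j.+4 * P j.+4) by ring.
rewrite betaE betaSE cP.
have -> : b j.+3 * P j.+1 * ((if odd j then 1 else t) * P j.+3 - b j.+4 * P j.+2) =
  b j.+3 * P j.+3 * ((if odd j then 1 else t) * P j.+1) - b j.+3 * P j.+1 * b j.+4 * P j.+2
  by ring.
by rewrite lo; ring.
Qed.

Hypothesis D_gt3 : (3 < D)%N.

Lemma beta_formula0 : beta_formula 0.
Proof.
have D2 := ltnW D_gt3; have := P_rec (ltnW D2); rewrite /= P0 P1 !mulr1 => tE.
have cP : c 2 * P 2 = t - b 2 by rewrite tE addrK.
split; last by rewrite c1 P0 mul1r mulr1 cP.
(* P_2 = 0 would mean t = b_2, and then [beta2E] would give b_2 b_3 = 0. *)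
apply: contraTneq isT => P2; move: beta2E; rewrite -cP P2 !mulr0 => /eqP.
rewrite eq_sym mulNr oppr_eq0 mulf_eq0.
by rewrite (negPf (b_neq0 (ltnW D_gt3))) (negPf (b_neq0 D_gt3)).
Qed.

(** If P_{j+3} vanished, [om_formula j] would equate 0 with a product of nonzero factors. The
    formula for beta then comes from [beta_rec], after cancelling om_{j+1}. *)
Lemma beta_formulaS j : (j.+3 < D)%N -> P j != 0 -> P j.+1 != 0 ->
  beta_formula j -> om_formula j -> beta_formula j.+1.
Proof.
move=> jD Pj Pj1 [Pj2 betaE] omE.
have jD1 := ltnW jD; have om0 := om_neq0 jD1.
have [c1' c2 c3] : [/\ c j.+1 != 0, c j.+2 != 0 & c j.+3 != 0].
  by split; apply: c_neq0; lia.
split.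
  apply/eqP => Pj3; move/eqP: omE; rewrite Pj3 mulr0; apply/negP.
  by rewrite !mulf_eq0 !negb_or om0 c1' Pj1 Pj2.
apply: (mulIf om0); apply: (mulIf (mulf_neq0 c1' Pj1)).
have -> : beta j.+3 * (c j.+2 * c j.+3 * P j.+3) * om j.+1 * (c j.+1 * P j.+1) =
    beta j.+3 * om j.+1 * (c j.+1 * c j.+2 * c j.+3 * P j.+1 * P j.+3) by ring.
rewrite beta_rec //; apply: (mulIf Pj2).
have -> : b j.+4 * beta j.+2 * (c j.+1 * c j.+2 * c j.+3 * P j.+1 * P j.+3) * P j.+2 =
    b j.+4 * (beta j.+2 * (c j.+1 * c j.+2 * P j.+2)) * (c j.+3 * P j.+1 * P j.+3) by ring.
have -> : - b j.+3 * b j.+4 * P j.+1 * om j.+1 * (c j.+1 * P j.+1) * P j.+2 =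
    - b j.+3 * b j.+4 * P j.+1 * (om j.+1 * (c j.+1 * P j.+1 * P j.+2)) by ring.
by rewrite betaE omE; ring.
Qed.

Lemma om_closed_form j : (j.+2 < D)%N ->
  om j.+1 = b j.+2 * c j.+3 / c j.+1 * (P j * P j.+3 / (P j.+1 * P j.+2)).
Proof.
(* The formulas feed each other: beta and om at i give beta at i+1, and beta at i and i+1 gives om
   at i+1. *)
have main i : (i.+2 < D)%N -> [/\ P i != 0, P i.+1 != 0, beta_formula i & om_formula i].
  elim: i => [|i IH] iD.
    have beta0 := beta_formula0.
    by split; rewrite ?P0 ?P1 ?oner_eq0 //; apply: om_formula0.
  have [Pi Pi1 bi oi] := IH (ltnW iD); have bi1 := beta_formulaS iD Pi Pi1 bi oi.
  by split=> //; [case: bi | apply: om_formulaS].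
move=> jD; have [_ Pj1 [Pj2 _] omE] := main _ jD.
have c1' : c j.+1 != 0 by apply: c_neq0; lia.
apply: (mulIf (mulf_neq0 (mulf_neq0 c1' Pj1) Pj2)); rewrite omE.
by field; rewrite c1' Pj1 Pj2.
Qed.

End ScalarRecursion.

(** * Finite choice, and linear independence of eigenvectors *)

Lemma bounded_choice (T : choiceType) (P : nat -> T -> bool) (t0 : T) n :
  (forall i, (i < n)%N -> exists t, P i t) ->
  exists f : nat -> T, forall i, (i < n)%N -> P i (f i).
Proof.
elim: n => [|n IH] exP; first by exists (fun=> t0).
have [f fP] := IH (fun i lt_in => exP i (ltnW lt_in)); have [t Pt] := exP n (ltnSn n).
exists (fun i => if i == n then t else f i) => i; rewrite ltnS leq_eqVlt.
by case: eqVneq => [->//|_ /= /fP].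
Qed.

Section Eigenvectors.

Variables (F : fieldType) (n : nat) (M : 'M[F]_n) (g : nat -> 'cV[F]_n) (a : nat -> F).

(** Applying M - a_m to a relation of length m+1 removes its last term and scales the others by the
    nonzero a_i - a_m. *)
Lemma eigenvectors_indep m (y : nat -> F) :
  (forall i j, (i < j < m)%N -> a i != a j) ->
  (forall i, (i < m)%N -> M *m g i = a i *: g i) ->
  (forall i, (i < m)%N -> g i != 0) ->
  \sum_(i < m) y i *: g i = 0 -> forall i, (i < m)%N -> y i = 0.
Proof.
elim: m y => [//|m IH] y a_inj Mg g0 zg.
have y0 i : (i < m)%N -> y i = 0.
  move=> im; have am : a i - a m != 0 by rewrite subr_eq0 a_inj // im /=.
  apply: (mulIf am); rewrite mul0r.
  apply: (IH (fun i => y i * (a i - a m))) => // [j l /andP[jl lm]|j jm|j jm|].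
  - by rewrite a_inj // jl ltnW.
  - by rewrite Mg // ltnW.
  - by rewrite g0 // ltnW.
  have := congr1 (fun w => M *m w - a m *: w) zg.
  rewrite /= mulmx0 scaler0 subrr mulmx_sumr scaler_sumr -sumrB big_ord_recr /=.
  rewrite -scalemxAr Mg // [y m *: (a m *: _)]scalerA [a m *: (_ *: _)]scalerA.
  rewrite [y m * _]mulrC subrr addr0.
  move=> z0; rewrite -[RHS]z0; apply: eq_bigr => j _.
  by rewrite -scalemxAr (Mg j) ?leqW // !scalerA -scalerBl mulrBr [a m * _]mulrC.
move=> i; rewrite ltnS leq_eqVlt => /orP[/eqP->|/y0//].
move: zg; rewrite big_ord_recr big1 /= => [|j _]; last by rewrite y0 ?scale0r.
by rewrite add0r => /eqP; rewrite scaler_eq0 (negPf (g0 m _)) // orbF => /eqP.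
Qed.

Lemma eigenvectors_free m :
  (forall i j, (i < j < m)%N -> a i != a j) ->
  (forall i, (i < m)%N -> M *m g i = a i *: g i) ->
  (forall i, (i < m)%N -> g i != 0) ->
  free [tuple g i | i < m].
Proof.
move=> a_inj Mg g0; apply/freeP => z zg i.
pose y j := if insub j is Some l then z l else 0.
have yE (l : 'I_m) : y l = z l by rewrite /y valK.
rewrite -yE; apply: (eigenvectors_indep a_inj Mg g0) => //.
by rewrite -[RHS]zg; apply: eq_bigr => j _; rewrite yE -tnth_nth tnth_mktuple.
Qed.

End Eigenvectors.

(** * The vectors p_j(A) v and the A-stable subspaces containing v *)

Section Module.

Variables (C : numClosedFieldType) (X : finType) (e : rel X).
Hypothesis e_sym : symmetric e.
Hypothesis e_conn : connected_graph e.
Hypothesis e_irr : irreflexive e.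
Hypothesis e_bip : bipartite e.
Variable k : nat.
Hypothesis e_val : valency e k.
Hypothesis e_dr : distance_regular e.
Variables (x : X) (v : 'cV[C]_#|X|).

Local Notation A := (adjmx C e).
Local Notation D := (diameter e).
Local Notation E i := (dualE C e x i).
Local Notation c i := ((cnum e i)%:R : C).
Local Notation b i := ((bnum e i)%:R : C).
Local Notation s j := (ballmx C e j *m v).

Lemma adj_ball i : (i < D)%N -> A *m s i =
  c i.+1 *: s i.+1 + b i.+1 *: (if i is i'.+1 then s i' else 0).
Proof.
move=> iD; rewrite mulmxA (adj_ballmx _ e_sym e_conn e_irr e_bip e_val) // mulmxDl -!scalemxAl.
by case: i {iD} => [|i] //; rewrite mul0mx.
Qed.

Lemma ball_in (U : {vspace 'cV[C]_#|X|}) :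
  v \in U -> (forall z, z \in U -> A *m z \in U) ->
  forall j, (j <= D)%N -> s j \in U.
Proof.
move=> vU AU j jD; suff: forall i, (i <= j)%N -> s i \in U by exact.
elim: j jD => [|j IH] jD i.
  by rewrite leqn0 => /eqP->; rewrite ballmx0 // mul1mx.
rewrite leq_eqVlt => /orP[/eqP->|]; last by apply: IH; apply: ltnW.
have IHj := IH (ltnW jD).
have cj : c j.+1 != 0 by apply: (cnum_neq0 C e_sym e_conn e_irr e_bip e_dr x).
have -> : s j.+1 = (c j.+1)^-1 *: (A *m s j - b j.+1 *: (if j is i'.+1 then s i' else 0)).
  by rewrite adj_ball // addrK scalerA mulVf // scale1r.
apply/memvZ/memvB; first by apply/AU/IHj.
by apply: memvZ; case: j {IH jD cj} IHj => [|j] IHj; [apply: mem0v | apply: IHj].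
Qed.

Hypothesis Ev : E 2 *m v = v.
Hypothesis sum_v : \sum_r v r 0 = 0.

(** Levels above j+2 are out of reach, levels up to j-2 vanish because the entries of v sum to 0,
    and levels j-1 and j+1 have the wrong parity. *)
Lemma ball_split j : s j = E j.+2 *m s j + E j *m s j.
Proof.
apply/colP => r; rewrite [RHS]mxE !dualE_mulE -mulrDl.
have zero h : gdist e x (enum_val r) = h -> E h *m s j = 0 -> s j r 0 = 0.
  move=> dr; rewrite -dr => /colP/(_ r); rewrite dualE_mulE eqxx mul1r => ->.
  by rewrite mxE.
case: ltngtP (erefl (gdist e x (enum_val r))) => [lt2|gt2|->] _; last first.
- by rewrite eqn_leq leqNgt ltnS leqnSn addr0 mul1r.
- rewrite (zero _ erefl) ?mulr0 //; exact: dualE_ballmx_far.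
rewrite add0r; case: eqVneq => [_|neq]; rewrite ?mul1r // mul0r.
apply: zero (erefl _) _.
case: (boolP (odd j == odd (gdist e x (enum_val r)))) => par; last exact: dualE_ballmx_parity.
apply: dualE_ballmx_near => //; rewrite leqNgt; apply/negP => gt2.
have /orP[] : (gdist e x (enum_val r) == j.+1) || (j == (gdist e x (enum_val r)).+1) by lia.
  by move=> /eqP dj; move: par; rewrite dj /=; case: (odd j).
by move=> /eqP dj; move: par; rewrite {1}dj /=; case: (odd _).
Qed.



Hypothesis D_ge4 : (4 <= diameter e)%N.

(* 1 / cd_weight m is the squared norm of p_m, for the norm with p_0 of norm 1
   making the p_j orthogonal. *)
Definition cd_weight m : C := \prod_(l < m) (c l.+1 / b l.+2).

(** The Christoffel-Darboux kernel, with p_j(A) in one of its two arguments, applied to v. *)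
Definition cd_kernel t m : 'cV[C]_#|X| :=
  \sum_(j < m.+1) ((ppoly C e j).[t] * cd_weight j) *: s j.

(** The weights satisfy b_{m+2} [cd_weight m.+1] = c_{m+1} [cd_weight m], so the boundary term at m
    cancels against part of the new summand. *)
Lemma christoffel_darboux t m : (m.+1 < D)%N ->
  A *m cd_kernel t m - t *: cd_kernel t m =
  (c m.+1 * cd_weight m) *: ((ppoly C e m).[t] *: s m.+1 - (ppoly C e m.+1).[t] *: s m).
Proof.
have p_rec := @ppoly_horner_rec C _ _ e_sym e_conn e_irr e_bip _ e_val e_dr x.
elim: m => [|m IH] mD.
  have := p_rec 0 t (ltnW mD); rewrite ppoly0 hornerC mulr1 mulr0 addr0 => tE.
  rewrite /cd_kernel big_ord1 ppoly0 hornerC /cd_weight big_ord0 !mulr1 !scale1r.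
  by rewrite adj_ball ?(ltnW mD) // scaler0 addr0 scalerBr scalerA -tE.
rewrite /cd_kernel big_ord_recr -/(cd_kernel t m) /= mulmxDr scalerDr opprD addrACA.
rewrite IH ?(ltnW mD) // -scalemxAr adj_ball ?(ltnW mD) //.
have := p_rec m.+1 t (ltnW mD); rewrite /= => tE.
have -> : cd_weight m.+1 = cd_weight m * (c m.+1 / b m.+2) by rewrite /cd_weight big_ord_recr.
have b2 : b m.+2 != 0 by apply: (bnum_neq0 C e_sym e_conn e_irr e_dr x).
move: (s m.+2) (s m.+1) (s m) => S2 S1 S0; apply/colP => r; rewrite !mxE.
have -> : t * ((ppoly C e m.+1).[t] * (cd_weight m * (c m.+1 / b m.+2)) * S1 r 0) =
    (t * (ppoly C e m.+1).[t]) * ((cd_weight m * (c m.+1 / b m.+2)) * S1 r 0) by ring.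
by rewrite tE; field; rewrite b2.
Qed.

Variable eta : C.
Hypothesis v_eta : E 2 *m (distmx C e 2 *m v) = eta *: v.

Lemma dualE2_ball2 : E 2 *m s 2 = (1 + eta) *: v.
Proof. by rewrite dualE2_ballmx2 // v_eta addrC scalerDl scale1r. Qed.

(** Only s_0 and s_2 meet level 2: odd j has the wrong parity, and j >= 4 falls under
    [dualE_ballmx_near]. The coefficient uses p_2(t) = (t^2 - b_2) / c_2 and [cd_weight 2] = c_1 c_2
    / (b_2 b_3). *)
Lemma dualE2_cd_kernel t : E 2 *m cd_kernel t D.-2 =
  (1 + (1 + eta) * ((t ^+ 2 - b 2) / (b 2 * b 3))) *: v.
Proof.
have p_rec := @ppoly_horner_rec C _ _ e_sym e_conn e_irr e_bip _ e_val e_dr x.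
have cn0 := cnum_neq0 C e_sym e_conn e_irr e_bip e_dr x.
have c1 : c 1 = 1 by rewrite (cnum1 e_sym e_conn e_irr e_bip e_dr x) //; lia.
have p1 : (ppoly C e 1).[t] = t.
  have := p_rec 0 t (ltnW (ltnW (ltnW D_ge4))).
  by rewrite c1 ppoly0 hornerC mulr0 addr0 mul1r mulr1.
have p2 : (ppoly C e 2).[t] = (t ^+ 2 - b 2) / c 2.
  have := p_rec 1 t (ltnW (ltnW D_ge4)); rewrite /= p1 ppoly0 hornerC mulr1 -expr2 => ->.
  by rewrite addrK mulrC mulKf ?cn0 //; lia.
rewrite /cd_kernel mulmx_sumr.
have D1 : (2 < D.-2.+1)%N by lia.
have D0 : (0 < D.-2.+1)%N by lia.
rewrite (bigD1 (Ordinal D0)) // (bigD1 (Ordinal D1)) //= big1 => [|[j /= jD]]; last first.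
  rewrite -!val_eqE /= => /andP[j0 j2]; rewrite -scalemxAr.
  have [oj|oj] := boolP (odd j == odd 2); last by rewrite dualE_ballmx_parity // scaler0.
  rewrite dualE_ballmx_near ?scaler0 //.
  by case: j j0 j2 oj {jD} => [|[|[|[|]]]].
rewrite addr0 -!scalemxAr ppoly0 hornerC /cd_weight big_ord0 mulr1 scale1r ballmx0 // mul1mx Ev.
rewrite dualE2_ball2 scalerA -[v in v + _]scale1r -scalerDl; congr (_ *: _); congr (_ + _).
rewrite p2 !big_ord_recl big_ord0 /= c1 mulr1 [RHS]mulrC; congr (_ * _).
have c2 : c 2 != 0 by apply: cn0; lia.
have b2 : b 2 != 0 by apply: (bnum_neq0 C e_sym e_conn e_irr e_dr x); lia.
have b3 : b 3 != 0 by apply: (bnum_neq0 C e_sym e_conn e_irr e_dr x); lia.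
by field; rewrite c2 b2 b3.
Qed.

Hypothesis v_neq0 : v != 0.
Variable theta : nat -> C.
Hypothesis htheta : ordered_eigenvalues e theta.
Hypothesis eta_gt : theta_tilde e (theta 1) < eta.
Hypothesis eta_lt : eta < theta_tilde e (theta D./2).

(* For t = theta_i with 0 < i < D, both terms on the right-hand side of
   christoffel_darboux vanish at m = D-2, so cd_kernel is an eigenvector. *)
Lemma invariant_dim (U : {vspace 'cV[C]_#|X|}) :
  v \in U -> (forall z, z \in U -> A *m z \in U) -> (D.-1 <= \dim U)%N.
Proof.
move=> vU AU; have [dec _] := htheta.
(* The shift selects theta_1, ..., theta_{D-1}, the D-1 eigenvalues other than k and -k. *)
pose g i := cd_kernel (theta i.+1) D.-2.
have Ag i : (i < D.-1)%N -> A *m g i = theta i.+1 *: g i.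
  move=> iD; apply/eqP; rewrite -subr_eq0 christoffel_darboux; last by lia.
  have -> : D.-2.+1 = D.-1 by lia.
  rewrite (ballmx_diameter_pred e_sym e_conn e_bip Ev sum_v) ?scaler0; last by lia.
  rewrite (ppoly_theta e_sym e_conn e_irr e_bip e_val x e_dr htheta); last by lia.
  by rewrite scale0r subrr scaler0.
have g0 i : (i < D.-1)%N -> g i != 0.
  move=> iD; apply/eqP => gi0; have := dualE2_cd_kernel (theta i.+1).
  rewrite -/(g i) gi0 mulmx0 => /esym/eqP; rewrite scaler_eq0 (negPf v_neq0) orbF.
  apply/negP.
  apply: (theta_tilde_gap e_sym e_conn e_irr e_bip e_val x htheta _ eta_gt eta_lt); first by lia.
  by rewrite mulr_gt0 // ltr0n (bnum_gt0 e_sym e_conn e_irr e_dr x) //; lia.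
have a_inj i j : (i < j < D.-1)%N -> theta i.+1 != theta j.+1.
  by move=> ij; rewrite gt_eqF // dec //; lia.
have := eigenvectors_free a_inj Ag g0; rewrite /free size_tuple => /eqP <-.
apply/dimvS/span_subvP => z /tnthP[i ->]; rewrite tnth_mktuple.
apply: rpred_sum => j _; apply/memvZ/ball_in => //.
by have := ltn_ord j; lia.
Qed.

End Module.

(** * The standard Hermitian form on column vectors *)

Section HermitianForm.

Variables (C : numClosedFieldType) (n : nat).
Implicit Types (y z : 'cV[C]_n) (M : 'M[C]_n).

Lemma dotmx_self_eq0 y : (map_mx Num.conj y)^T *m y = 0 -> y = 0.
Proof.
move=> /matrixP/(_ 0 0); rewrite !mxE => /eqP; rewrite psumr_eq0 => [/allP y0|r _].
  apply/colP => r; rewrite mxE; apply/eqP; have := y0 r.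
  by rewrite mem_index_enum !mxE mulrC mul_conjC_eq0; apply.
by rewrite !mxE mulrC mul_conjC_ge0.
Qed.

Lemma dotmx_adjoint M y z : M^T = M -> map_mx Num.conj M = M ->
  (map_mx Num.conj (M *m y))^T *m z = (map_mx Num.conj y)^T *m (M *m z).
Proof. by move=> MT Mc; rewrite map_mxM trmx_mul Mc MT mulmxA. Qed.

End HermitianForm.

(** * Thin modules with endpoint 2 and the basis of vectors w_j *)

Section ThinModule.

Variables (C : numClosedFieldType) (X : finType) (e : rel X).
Hypothesis e_sym : symmetric e.
Hypothesis e_conn : connected_graph e.
Hypothesis e_irr : irreflexive e.
Hypothesis e_bip : bipartite e.
Variable k : nat.
Hypothesis e_val : valency e k.
Hypothesis e_dr : distance_regular e.
Hypothesis D_ge4 : (4 <= diameter e)%N.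
Variables (x : X) (W : {vspace 'cV[C]_#|X|}).
Hypothesis W_mod : Tmodule e x W.
Hypothesis W_thin : thin e x W.
Hypothesis W_end : has_endpoint e x W 2.

Local Notation A := (adjmx C e).
Local Notation D := (diameter e).
Local Notation E i := (dualE C e x i).
Local Notation c i := ((cnum e i)%:R : C).
Local Notation b i := ((bnum e i)%:R : C).

Lemma adj_in z : z \in W -> A *m z \in W.
Proof. exact/W_mod/Terw_adj. Qed.

Lemma dualE_in i z : z \in W -> E i *m z \in W.
Proof.
have [iD|Di] := leqP i D; first exact/W_mod/Terw_dual.
by rewrite dualE_gt // mem0v.
Qed.

Lemma mem_Ecomp i z : z \in W -> E i *m z \in Ecomp e x i W.
Proof. by move=> zW; apply/memv_imgP; exists z; rewrite ?lfunE. Qed.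

Lemma EcompP i z : z \in Ecomp e x i W -> z \in W /\ E i *m z = z.
Proof. by case/memv_imgP => u uW ->; rewrite lfunE /= dualE_idem dualE_in. Qed.

Lemma dualE_endpoint i z : (i < 2)%N -> z \in W -> E i *m z = 0.
Proof.
have [_ W0] := W_end; move=> /W0 Wi0 /(mem_Ecomp i).
by rewrite Wi0 memv0 => /eqP.
Qed.

(** A nonzero vector spans a space of dimension at most one. The equality is boolean so that
    [bounded_choice] applies to it. *)
Lemma thin_line i u w : u \in W -> w \in W -> E i *m w = w -> w != 0 ->
  exists a, E i *m u == a *: w.
Proof.
move=> uW wW Ew w0; have [iD|Di] := leqP i D; last first.
  by exists 0; rewrite dualE_gt // scale0r.
have wE : w \in Ecomp e x i W by rewrite -Ew mem_Ecomp.
have : (Ecomp e x i W <= <[w]>)%VS.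
  by rewrite -(geq_leqif (dimv_leqif_sup _)) ?dim_vline ?w0 ?W_thin // -memvE.
by move=> /subvP/(_ _ (mem_Ecomp i uW))/vlineP[a ->]; exists a.
Qed.

Variable v : 'cV[C]_#|X|.
Hypothesis v_in : v \in Ecomp e x 2 W.
Hypothesis v_neq0 : v != 0.
Local Notation s j := (ballmx C e j *m v).

Lemma endpoint_vector_in : v \in W. Proof. by case: (EcompP v_in). Qed.

Lemma dualE2_endpoint_vector : E 2 *m v = v. Proof. by case: (EcompP v_in). Qed.

Lemma ball_inW j : (j <= D)%N -> s j \in W.
Proof. exact: (ball_in e_sym e_conn e_irr e_bip e_val e_dr x endpoint_vector_in adj_in). Qed.

(** All of level 2 is at distance 2 from [x], so this sum is the entry at [x] of p_2(A) v, which
    vanishes because E*_0 W = 0. *)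
Lemma sum_endpoint_vector : \sum_r v r 0 = 0.
Proof.
have : E 0 *m s 2 = 0 by apply: dualE_endpoint => //; apply: ball_inW; lia.
move=> /colP/(_ (enum_rank x)); rewrite dualE_mulE enum_rankK gdistxx // mul1r [RHS]mxE.
move=> s2x; rewrite -[RHS]s2x (ballmx_mulE dualE2_endpoint_vector) [RHS]big_mkcond.
apply: eq_bigr => r _; rewrite enum_rankK.
by case: eqP => [->//|/eqP/(level2P dualE2_endpoint_vector)->].
Qed.

Variable eta : C.
Hypothesis W_eta : local_eigenvalue e x W eta.

(** By thinness v is a multiple of the eigenvector supplied by [W_eta]. *)
Lemma local_eigenvector : E 2 *m (distmx C e 2 *m v) = eta *: v.
Proof.
have [w [/EcompP[wW Ew] w0]] := W_eta; rewrite -!mulmxA Ew => eta_w.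
have [a /eqP] := thin_line endpoint_vector_in wW Ew w0; rewrite dualE2_endpoint_vector => ->.
by rewrite -!scalemxAr eta_w !scalerA mulrC.
Qed.

(* In ball_split, s_j = wvec j + E*_j s_j; dualE_ballmx_top identifies wvec j
   with E*_{j+2} A_j v. *)
Definition wvec j := E j.+2 *m s j.

Lemma dualE_wvec j : E j.+2 *m wvec j = wvec j.
Proof. exact: dualE_idem. Qed.

Lemma wvec_in j : wvec j \in W.
Proof.
have [jD|Dj] := leqP j D; first exact/dualE_in/ball_inW.
by rewrite /wvec dualE_gt ?mem0v //; lia.
Qed.

Lemma wvec0 : wvec 0 = v.
Proof. by rewrite /wvec ballmx0 // mul1mx dualE2_endpoint_vector. Qed.

(** There is no level D+1. This makes the last column of the matrix fit the general pattern. *)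
Lemma wvec_diameter : wvec D.-1 = 0.
Proof. by rewrite /wvec dualE_gt // ltnS leqSpred. Qed.

(** Compare level j+3 in the recurrence for A s_j: neither A E*_j s_j nor s_{j-1} reaches beyond
    level j+1. *)
Lemma raise_wvec j : (j < D)%N -> E j.+3 *m (A *m wvec j) = c j.+1 *: wvec j.+1.
Proof.
move=> jD; have := congr1 (mulmx (E j.+3))
  (adj_ball e_sym e_conn e_irr e_bip e_val e_dr v jD).
rewrite {1}(ball_split e_sym e_conn e_bip dualE2_endpoint_vector sum_endpoint_vector j) !mulmxDr.
have -> : E j.+3 *m (A *m (E j *m s j)) = 0 by apply: dualE_adj => //; lia.
rewrite addr0 => ->; rewrite -!scalemxAr; case: j jD => [|j] jD.
  by rewrite mulmx0 scaler0 addr0.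
by rewrite (dualE_ballmx_far (i := j) e_sym e_conn dualE2_endpoint_vector) ?scaler0 ?addr0.
Qed.

Lemma adj_dualE_split i (z : 'cV[C]_#|X|) : A *m (E i.+1 *m z) =
  E i.+2 *m (A *m (E i.+1 *m z)) + E i *m (A *m (E i.+1 *m z)).
Proof.
have zero h : h != i.+2 -> h != i -> E h *m (A *m (E i.+1 *m z)) = 0.
  by move=> h2 hi; apply: dualE_adj.
apply/colP => r; rewrite [RHS]mxE !dualE_mulE -mulrDl.
have [h2|h2] := eqVneq (gdist e x (enum_val r)) i.+2.
  by rewrite h2 [i.+2 == i]eqn_leq (leqNgt i.+2) ltnW //= addr0 mul1r.
rewrite add0r; have [_|hi] := eqVneq (gdist e x (enum_val r)) i; rewrite ?mul1r // mul0r.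
have /colP/(_ r) := zero _ h2 hi.
by rewrite dualE_mulE eqxx mul1r => ->; rewrite mxE.
Qed.

Lemma adj_wvec0 : A *m wvec 0 = c 1 *: wvec 1.
Proof.
rewrite {1}/wvec adj_dualE_split -/(wvec 0) raise_wvec; last by lia.
by rewrite (dualE_endpoint (i := 1)) ?addr0 // adj_in // wvec_in.
Qed.

Lemma adj_wvecS j : (j.+1 < D)%N ->
  A *m wvec j.+1 = c j.+2 *: wvec j.+2 + E j.+2 *m (A *m wvec j.+1).
Proof. by move=> jD; rewrite {1}/wvec [LHS]adj_dualE_split -/(wvec j.+1) raise_wvec. Qed.

Variable theta : nat -> C.
Hypothesis htheta : ordered_eigenvalues e theta.
Hypothesis eta_gt : theta_tilde e (theta 1) < eta.
Hypothesis eta_lt : eta < theta_tilde e (theta D./2).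

Let dim_ge U := invariant_dim e_sym e_conn e_irr e_bip e_val e_dr
  dualE2_endpoint_vector sum_endpoint_vector D_ge4
  local_eigenvector v_neq0 htheta eta_gt eta_lt (U := U).

(* If wvec j.+1 = 0, the span of wvec 0, ..., wvec j is A-stable and contains v,
   but its dimension is too small. *)
Lemma wvec_neq0 j : (j < D.-1)%N -> wvec j != 0.
Proof.
move=> jD; suff: (forall i, (i <= j)%N -> wvec i != 0) by apply.
elim: j jD => [|j IH] jD i; first by rewrite leqn0 => /eqP->; rewrite wvec0.
have {}IH := IH (ltnW jD); rewrite leq_eqVlt => /orP[/eqP-> {i}|]; last exact: IH.
apply/eqP => wj0; pose U := <<[seq wvec i | i <- iota 0 j.+1]>>%VS.
have wU i : (i <= j)%N -> wvec i \in U.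
  by move=> ij; apply/memv_span/map_f; rewrite mem_iota.
have : (D.-1 <= \dim U)%N.
  apply: dim_ge => [|z zU]; first by rewrite -wvec0 wU.
  have : (linfun (mulmx A : 'cV[C]_#|X| -> 'cV[C]_#|X|) @: U <= U)%VS.
    rewrite limg_span; apply/span_subvP => _ /mapP[_ /mapP[i + ->] ->].
    rewrite mem_iota lfunE /= add0n ltnS => ij.
    have wSU : wvec i.+1 \in U.
      move: ij; rewrite leq_eqVlt => /orP[/eqP->|]; last exact: wU.
      by rewrite wj0 mem0v.
    case: i ij wSU => [|i] ij wSU; first by rewrite adj_wvec0 memvZ.
    rewrite adj_wvecS; last by lia.
    apply: memvD; first exact: memvZ.
    have [a /eqP->] := thin_line (adj_in (wvec_in i.+1)) (wvec_in i) (dualE_wvec i)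
      (IH _ (ltnW ij)).
    by apply/memvZ/wU/ltnW.
  by move=> /subvP; apply; apply/memv_imgP; exists z; rewrite ?lfunE.
apply/negP; rewrite -ltnNge; apply: leq_ltn_trans (dim_span _) _.
by rewrite size_map size_iota.
Qed.

(** By thinness every E*_{i+2} z is a multiple of w_i, so the w_i span W; their number D-1 is at
    most dim W by [dim_ge]. *)
Lemma wvec_basis : basis_of W [tuple wvec i | i < D.-1].
Proof.
rewrite basisEdim; apply/andP; split; last first.
  by rewrite size_tuple; apply: dim_ge endpoint_vector_in adj_in.
apply/subvP => z zW; rewrite -(sum_dualE e x z); apply: rpred_sum => -[i iD] _ /=.
case: i iD => [|[|i]] iD; [by rewrite dualE_endpoint ?mem0v // ..|].
have iD' : (i < D.-1)%N by lia.
have [a /eqP->] := thin_line zW (wvec_in i) (dualE_wvec i) (wvec_neq0 iD').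
have -> : wvec i = tnth [tuple wvec l | l < D.-1] (Ordinal iD') by rewrite tnth_mktuple.
exact/memvZ/memv_span/mem_tnth.
Qed.

(** * The coefficients omega_i and beta_i *)

Section Coefficients.

Variables om beta : nat -> C.
Hypothesis omE : forall j, (j.+2 < D)%N ->
  E j.+2 *m (A *m wvec j.+1) = om j.+1 *: wvec j.
Hypothesis betaE : forall j, (j.+1 < D)%N -> E j.+2 *m s j.+2 = beta j.+2 *: wvec j.

Let scale_inj j p q : (j < D.-1)%N -> p *: wvec j = q *: wvec j -> p = q.
Proof.
move=> jD /eqP; rewrite -subr_eq0 -scalerBl scaler_eq0 (negPf (wvec_neq0 jD)) orbF.
by rewrite subr_eq0 => /eqP.
Qed.

(** Taking h = i+1 yields [om1E] and [omSSE]; taking h = i-1 yields [beta_recE]. *)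
Let adj_sE i h : (i < D)%N ->
  E h *m (A *m wvec i) + E h *m (A *m (E i *m s i)) =
  c i.+1 *: (E h *m s i.+1) + b i.+1 *: (E h *m (if i is i'.+1 then s i' else 0)).
Proof.
move=> iD; have := congr1 (mulmx (E h))
  (adj_ball e_sym e_conn e_irr e_bip e_val e_dr v iD).
rewrite {1}(ball_split e_sym e_conn e_bip dualE2_endpoint_vector sum_endpoint_vector i).
by rewrite !mulmxDr -!scalemxAr.
Qed.

Lemma beta2E : beta 2 = 1 + eta.
Proof.
apply: (scale_inj (j := 0)); first by lia.
by rewrite -betaE ?(dualE2_ball2 e_conn dualE2_endpoint_vector local_eigenvector) ?wvec0 //; lia.
Qed.

Lemma om1E : om 1 = c 2 * beta 2 + b 2.
Proof.
have D2 : (2 < D)%N by lia.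
apply: (scale_inj (j := 0)); first by lia.
have := adj_sE 2 (ltnW D2); rewrite (dualE_endpoint (i := 1)) ?ball_inW ?(ltnW (ltnW D2)) //.
by rewrite !mulmx0 addr0 omE // betaE ?(ltnW D2) // -/(wvec 0) => ->; rewrite scalerDl scalerA.
Qed.

Lemma omSSE j : (j.+3 < D)%N ->
  om j.+2 + beta j.+2 * c j.+1 = c j.+3 * beta j.+3 + b j.+3.
Proof.
move=> jD; apply: (scale_inj (j := j.+1)); first by lia.
have := adj_sE j.+3 (ltnW jD); rewrite omE // (betaE (j := j)); last by lia.
rewrite -!scalemxAr raise_wvec; last by lia.
by rewrite betaE ?(ltnW jD) // -/(wvec j.+1) !scalerA -!scalerDl.
Qed.

Lemma beta_recE j : (j.+3 < D)%N -> beta j.+3 * om j.+1 = b j.+4 * beta j.+2.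
Proof.
move=> jD; apply: (scale_inj (j := j)); first by lia.
have wj0 : E j.+2 *m (A *m wvec j.+3) = 0 by apply: dualE_adj => //; lia.
have := adj_sE j.+2 jD; rewrite wj0 add0r (betaE (j := j.+1)); last by lia.
rewrite -!scalemxAr omE; last by lia.
rewrite (dualE_ballmx_near e_sym e_conn e_bip dualE2_endpoint_vector sum_endpoint_vector) //.
rewrite scaler0 add0r.
by rewrite betaE ?scalerA //; lia.
Qed.

(* om_{j+1} |wvec j|^2 = c_{j+1} |wvec (j+1)|^2, because A is self-adjoint. *)
Lemma om_neq0 j : (j.+2 < D)%N -> om j.+1 != 0.
Proof.
move=> jD; have jD1 : (j.+1 < D.-1)%N by lia.
have AT : A^T = A by apply: adjmx_sym.
have Ac : map_mx Num.conj A = A by apply/matrixP => p q; rewrite !mxE rmorph_nat.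
have ET i : (E i)^T = E i by apply: tr_diag_mx.
have Ec i : map_mx Num.conj (E i) = E i.
  by apply/matrixP => p q; rewrite !mxE rmorphMn rmorph_nat.
apply: contraNneq (wvec_neq0 jD1) => om0; apply/eqP/dotmx_self_eq0.
have cj : c j.+1 != 0 by apply: (cnum_neq0 C e_sym e_conn e_irr e_bip e_dr x); lia.
have : (map_mx Num.conj (c j.+1 *: wvec j.+1))^T *m wvec j.+1 = 0.
  rewrite -raise_wvec; last by lia.
  rewrite dotmx_adjoint // dualE_wvec dotmx_adjoint //.
  by rewrite -[X in map_mx _ X]dualE_wvec dotmx_adjoint // omE // om0 scale0r mulmx0.
rewrite map_mxZ linearZ -scalemxAl => /eqP; rewrite scaler_eq0 conjC_eq0 (negPf cj).
by move=> /eqP.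
Qed.

(** With beta_2 = 1 + eta nonzero, [psi e eta] is the t solving beta_2 (t - b_2) = - b_2 b_3, the
    initial condition of the recursion; for eta = -1, beta_2 vanishes. *)
Lemma om_omega j : (j.+2 < D)%N -> om j.+1 = omega e eta j.+1.
Proof.
have c_n0 := cnum_neq0 C e_sym e_conn e_irr e_bip e_dr x.
have b_n0 := bnum_neq0 C e_sym e_conn e_irr e_dr x.
move=> jD; rewrite /omega; case: eqVneq => [eta_m1|eta_neq].
  apply: (om_of_beta2_eq0 (c := fun i => c i) (b := fun i => b i)
    om_neq0 om1E omSSE beta_recE) => //.
  by rewrite beta2E eta_m1 subrr.
have eta1 : 1 + eta != 0 by rewrite addrC -subr_eq0 opprK in eta_neq *.
have c1 : c 1 = 1 by rewrite (cnum1 e_sym e_conn e_irr e_bip e_dr x) //; lia.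
rewrite (om_closed_form (c := fun i => c i) (b := fun i => b i)
  (P := fun j => (Ppoly C e j).[psi e eta]) (t := psi e eta)
  c_n0 b_n0 om_neq0 om1E omSSE beta_recE c1) //.
- by rewrite (Ppoly0 C e) hornerC.
- by rewrite (Ppoly1 C e_sym e_conn e_irr e_bip e_dr x) ?hornerC //; lia.
- by move=> i iD; apply: Ppoly_rec.
- by rewrite beta2E.
- by rewrite beta2E /psi; field.
Qed.

End Coefficients.

Lemma wvec_coefficients : exists om beta : nat -> C,
  (forall j, (j.+2 < D)%N -> E j.+2 *m (A *m wvec j.+1) = om j.+1 *: wvec j) /\
  (forall j, (j.+1 < D)%N -> E j.+2 *m s j.+2 = beta j.+2 *: wvec j).
Proof.
have line u j : (j < D.-1)%N -> u \in W -> exists a, E j.+2 *m u == a *: wvec j.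
  by move=> jD uW; apply: thin_line => //; [apply: wvec_in|apply: dualE_wvec|apply: wvec_neq0].
have [om omP] : exists om : nat -> C, forall j, (j < D.-2)%N ->
    E j.+2 *m (A *m wvec j.+1) == om j *: wvec j.
  apply: (bounded_choice (P := fun j a => E j.+2 *m (A *m wvec j.+1) == a *: wvec j) 0) => j jD.
  by apply: line; [lia | apply/adj_in/wvec_in].
have [beta betaP] : exists beta : nat -> C, forall j, (j < D.-1)%N ->
    E j.+2 *m s j.+2 == beta j *: wvec j.
  apply: (bounded_choice (P := fun j a => E j.+2 *m s j.+2 == a *: wvec j) 0) => j jD.
  by apply: line => //; apply: ball_inW; lia.
(* The chosen families are indexed by the j of w_j; the predecessors restore the indices of om_{j+1}
   and beta_{j+2}. *)
exists (fun j => om j.-1), (fun j => beta j.-2); split=> j jD; apply/eqP.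
  by apply: omP; lia.
by apply: betaP; lia.
Qed.

Lemma adj_wvec j : (j < D.-1)%N -> A *m wvec j =
  c j.+1 *: wvec j.+1 + (if j is i.+1 then omega e eta j *: wvec i else 0).
Proof.
have [om [beta [omE betaE]]] := wvec_coefficients.
case: j => [|j] jD; first by rewrite adj_wvec0 addr0.
by rewrite adj_wvecS ?omE ?(om_omega omE betaE) //; lia.
Qed.

End ThinModule.

(** * Assembling the matrix of A *)

Theorem theorem16p6 (C : numClosedFieldType) (X : finType) (e : rel X)
  (D k : nat) (theta : nat -> C) (x : X) (W : {vspace 'cV[C]_#|X|}) (eta : C)
  (v : 'cV[C]_#|X|)
  (e_sym : symmetric e) (e_irr : irreflexive e)
  (e_conn : connected_graph e) (e_bip : bipartite e)
  (e_dr : distance_regular e)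
  (hD : diameter e = D) (D_ge4 : (4 <= D)%N)
  (hk : valency e k) (k_ge3 : (3 <= k)%N)
  (htheta : ordered_eigenvalues e theta)
  (W_irr : irreducible_Tmodule e x W) (W_thin : thin e x W)
  (W_end : has_endpoint e x W 2) (W_eta : local_eigenvalue e x W eta)
  (eta_gt : theta_tilde e (theta 1%N) < eta)
  (eta_lt : eta < theta_tilde e (theta D./2))
  (v_in : v \in Ecomp e x 2 W) (v_neq0 : v != 0) :
  represents (adjmx C e) W
    [tuple dualE C e x (i + 2) *m distmx C e i *m v | i < D.-1]
    (tridiag0 D.-1 (fun i => (cnum e i)%:R) (omega e eta)).
Proof.
subst D; have [W_mod _ _] := W_irr; have v2 := dualE2_endpoint_vector W_mod v_in.
have basis := wvec_basis e_sym e_conn e_irr e_bip hk e_dr D_ge4 W_mod W_thin W_end v_in v_neq0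
  W_eta htheta eta_gt eta_lt.
have adjE := adj_wvec e_sym e_conn e_irr e_bip hk e_dr D_ge4 W_mod W_thin W_end v_in v_neq0
  W_eta htheta eta_gt eta_lt.
have w0 : wvec e x v (diameter e).-1 = 0 by apply: wvec_diameter.
have -> : [tuple dualE C e x (i + 2) *m distmx C e i *m v | i < (diameter e).-1] =
    [tuple wvec e x v i | i < (diameter e).-1].
  apply: eq_from_tnth => i; rewrite !tnth_mktuple -mulmxA addn2.
  by rewrite -(dualE_ballmx_top e_sym e_conn v2).
split=> // j; rewrite tnth_mktuple adjE //.
(* Column j is split into its subdiagonal entry, in row j+1, and its superdiagonal entry, in row
   j-1. *)
rewrite (eq_bigr (fun r : 'I_(diameter e).-1 =>
    (if r == j.+1 :> nat then (cnum e r)%:R *: wvec e x v r else 0) +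
    (if r.+1 == j :> nat then omega e eta j *: wvec e x v r else 0))) => [|r _]; last first.
  rewrite tnth_mktuple mxE [in RHS]eq_sym; case: eqVneq => [->|_].
    by rewrite (gtn_eqF (ltnW (ltnSn _))) addr0.
  by rewrite add0r eq_sym; case: eqP; rewrite ?scale0r.
rewrite big_split /=; congr (_ + _).
  rewrite -big_mkcond /=; have [lt_j|ge_j] := ltnP j.+1 (diameter e).-1.
    by rewrite (big_pred1 (Ordinal lt_j)).
  (* In the last column row j+1 is missing, and the unmatched term is a multiple of w_{D-1} = 0. *)
  rewrite big_pred0 => [|r]; last by rewrite ltn_eqF // (leq_trans (ltn_ord r)).
  have -> : j.+1 = (diameter e).-1 by apply/eqP; rewrite eqn_leq ltn_ord.
  by rewrite w0 scaler0.
rewrite -big_mkcond /=; case: j => -[|j] jD /=; first by rewrite big_pred0.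
by rewrite (big_pred1 (Ordinal (ltnW jD))).
Qed.
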